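(* Let $N\in\mathbb{Z}$ with $|N|>1$ and let $\mathcal{D}\subset\mathbb{Z}$ be a finite set with $0\in\mathcal{D}$ and $\gcd(\mathcal{D})=1$. Let $\mathcal{S}\subset\mathbb{Z}$ with $0\in\mathcal{S}$ be such that $(\frac1N\mathcal{D},\mathcal{S})$ is a compatible pair. Then $(\mu_{N,\mathcal{D}},\Lambda(N,\mathcal{S}))$ is NOT a spectral pair if and only if there exist an integer $m\ge 1$, elements $s_j^*\in\mathcal{S}$ and nonzero integers $\eta_j$, $0\le j\le m-1$, such that $\eta_{j+1}=N^{-1}(\eta_j+s_j^* )$ for all $0\le j\le m-1$ (with $\eta_m:=\eta_0$ and $s_m^*:=s_0^*$).
   Context: Write $e(t)=e^{2\pi i t}$. For a probability measure $\mu$ on $\mathbb{R}$ and a set $\Lambda\subset\mathbb{R}$, $(\mu,\Lambda)$ is called a spectral pair if the functions $t\mapsto e(\lambda t)$, $\lambda\in\Lambda$, form an orthonormal basis of $L^2(\mu)$. For an integer $N$ with $|N|>1$ and a finite set $\mathcal{D}=\{d_1,\dots,d_q\}\subset\mathbb{Z}$ of cardinality $q$, $\mu_{N,\mathcal{D}}$ denotes the unique Borel probability measure on $\mathbb{R}$ satisfying $\mu=\sum_{j=1}^q \frac1q\,\mu\circ\phi_j^{-1}$, where $\phi_j(x)=\frac1N(x+d_j)$. Two finite sets $\mathcal{A}=\{a_1,\dots,a_q\}$ and $\mathcal{S}=\{s_1,\dots,s_q\}$ of real numbers, both of cardinality $q$, form a compatible pair $(\mathcal{A},\mathcal{S})$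 if the $q\times q$ matrix $\left[\frac{1}{\sqrt q}e(a_js_k)\right]_{j,k}$ is unitary. Here $\frac1N\mathcal{D}=\{d/N: d\in\mathcal{D}\}$. For a finite set $\mathcal{A}\subset\mathbb{R}$, $\Lambda(N,\mathcal{A})=\left\{\sum_{j=0}^k a_jN^j:\ k\ge 1,\ a_j\in\mathcal{A}\right\}$. $\gcd(\mathcal{D})$ is the greatest common divisor of all the elements of $\mathcal{D}$. *)

(* Defs.v *)
From HB Require Import structures.
From mathcomp Require Import all_boot all_order all_algebra finmap.
From mathcomp Require Import all_classical all_reals all_analysis.
From mathcomp Require Import complex.

Set Implicit Arguments.
Unset Strict Implicit.
Unset Printing Implicit Defensive.

Import Order.TTheory GRing.Theory Num.Theory.
Import numFieldNormedType.Exports.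

Local Open Scope classical_set_scope.
Local Open Scope fset_scope.
Local Open Scope ring_scope.

Definition e2pi (R : realType) (t : R) : R[i] :=
  (cos (2 * pi * t) +i* sin (2 * pi * t))%C.

(* MathComp-Analysis has no measurable structure on R[i] and integrates only
   real- and extended-real-valued functions: measurability and integrals of
   complex-valued functions are taken componentwise. *)

Definition Cmeasurable (R : realType) (f : measurableTypeR R -> R[i]) : Prop :=
  measurable_fun setT (fun x => complex.Re (f x)) /\
  measurable_fun setT (fun x => complex.Im (f x)).

Definition Cintegral (R : realType) (mu : probability (measurableTypeR R) R)
    (f : measurableTypeR R -> R[i]) : R[i] :=
  ((\int[mu]_x complex.Re (f x)) +i* (\int[mu]_x complex.Im (f x)))%C.

Definition L2norm (R : realType) (mu : probability (measurableTypeR R) R)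
    (f : measurableTypeR R -> R[i]) : \bar R :=
  'N[mu]_2%:E[EFin \o (@ComplexField.Normc.normc R \o f)]%E.

Definition in_L2 (R : realType) (mu : probability (measurableTypeR R) R)
    (f : measurableTypeR R -> R[i]) : Prop :=
  Cmeasurable f /\ (L2norm mu f < +oo)%E.

Definition L2inner (R : realType) (mu : probability (measurableTypeR R) R)
    (f g : measurableTypeR R -> R[i]) : R[i] :=
  Cintegral mu (fun x => f x * (g x)^*%C).

(* Orthonormal basis in the Hilbert space sense: an orthonormal family whose
   finite linear combinations are dense.  Elements of L^2(mu) are represented
   by functions rather than by almost-everywhere classes. *)
Definition orthonormal_basis (R : realType)
    (mu : probability (measurableTypeR R) R) (I : eqType) (A : set I)
    (b : I -> measurableTypeR R -> R[i]) : Prop :=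
  [/\ forall i, A i -> in_L2 mu (b i),
      forall i j, A i -> A j -> L2inner mu (b i) (b j) = (i == j)%:R &
      forall f, in_L2 mu f -> forall eps : R, 0 < eps ->
        exists (n : nat) (idx : 'I_n -> I) (c : 'I_n -> R[i]),
          (forall k, A (idx k)) /\
          (L2norm mu (fun x => f x - \sum_(k < n) c k * b (idx k) x)%R
             < eps%:E)%E].

Definition spectral_pair (R : realType)
    (mu : probability (measurableTypeR R) R) (Lambda : set R) : Prop :=
  orthonormal_basis mu Lambda (fun lambda t => e2pi (lambda * t)).

Definition phi (R : realType) (N d : int) (x : measurableTypeR R) :
    measurableTypeR R :=
  N%:~R^-1 * (x + d%:~R).

(* [is_muND N D mu] says that [mu] is the measure mu_{N,D}: by Hutchinson's
   theorem exactly one Borel probability measure satisfies this equation when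
   |N| > 1 and D is nonempty. *)
Definition is_muND (R : realType) (N : int) (D : {fset int})
    (mu : probability (measurableTypeR R) R) : Prop :=
  forall A : set (measurableTypeR R), measurable A ->
    mu A = (\sum_(d <- D) ((#|` D|%:R)^-1)%:E * pushforward mu (phi N d) A)%E.

(* The enumerations of A and S are those of the underlying duplicate-free
   sequences; unitarity does not depend on this choice. *)
Definition compatible_pair (R : realType) (A S : {fset R}) : Prop :=
  let q := #|` A| in
  #|` S| = q /\
  (\matrix_(j < q, k < q)
     (((Num.sqrt (q%:R : R))^-1)%:C%C * e2pi (A`_j * S`_k)))
  \is unitarymx.

Definition Lambda (R : realType) (N : int) (A : {fset R}) : set R :=
  [set x | exists (k : nat) (a : nat -> R),
     [/\ (1 <= k)%N, forall j, (j <= k)%N -> a j \in A &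
         x = \sum_(0 <= j < k.+1) a j * N%:~R ^+ j]].

Definition fset_gcd (D : {fset int}) : int := \big[gcdz/0]_(d <- D) d.

(* Main.v *)
(* Let p = |m_D|^2 for the mask m_D(x) = (1/q) sum_d e(d x), and g = |mu^|^2, so
   that g(x) = p(x/N) g(x/N).  Compatibility says that the transfer operator
   R h(x) = sum_s p((x+s)/N) h((x+s)/N) fixes constants; hence Lambda is orthonormal
   and Q = lim R^n g = sum_{l in Lambda} g(. + l) is a harmonic function, Q <= 1.
   Since exponentials are dense in L^2(mu), the pair is spectral as soon as Q = 1.

   As an increasing limit of continuous functions, a nonvanishing Q is bounded below
   by some c > 0 on every compact interval stable under the branches x |-> (x+s)/N,
   and then Q = 1 there: c(1 - Q) <= R^n(Q - Q^2) = Q - R^n(Q^2) -> 0.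
   Otherwise Q vanishes somewhere; its zeros in a stable interval are zeros of g,
   hence finitely many, and are mapped to each other by the branches of positive
   weight.  Counting weighted paths gives zeros with exactly one such branch; its
   weight is then 1, which forces its endpoint to be an integer because
   gcd(D) = 1.  Following these branches yields the cycle eta_j, and eta_j <> 0
   because Q(0) = 1.

   Conversely, for a cycle, e(-eta_0 t) is orthogonal to every e(l t), l in Lambda. *)
Require Import Defs.
From mathcomp Require Import all_boot all_order all_algebra finmap.
From mathcomp Require Import all_classical all_reals all_analysis.
From mathcomp Require Import complex.
From mathcomp Require Import measurable_realfun ring lra.

Import Order.TTheory GRing.Theory Num.Theory.
Import numFieldNormedType.Exports.

Set Implicit Arguments.
Unset Strict Implicit.
Unset Printing Implicit Defensive.

Local Open Scope classical_set_scope.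
Local Open Scope fset_scope.
Local Open Scope ring_scope.

(** * Exponentials *)

Section Exponential.
Variable R : realType.
Implicit Types (t : R) (z w : R[i]).

Lemma e2pi0 : e2pi 0 = 1 :> R[i].
Proof. by rewrite /e2pi mulr0 cos0 sin0. Qed.

Lemma e2piD t u : e2pi (t + u) = e2pi t * e2pi u.
Proof.
rewrite /e2pi mulrDr cosD sinD; simpc; congr (_ +i* _)%C.
by rewrite addrC.
Qed.

Lemma e2piN t : e2pi (- t) = (e2pi t)^*%C.
Proof. by rewrite /e2pi mulrN cosN sinN. Qed.

Lemma e2pi_nat (n : nat) : e2pi n%:R = 1 :> R[i].
Proof.
elim: n => [|n IHn]; first exact: e2pi0.
by rewrite -addn1 natrD e2piD IHn mul1r /e2pi mulr1 mulr_natl cos2pi sin2pi.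
Qed.

Lemma e2pi_int (k : int) : e2pi k%:~R = 1 :> R[i].
Proof.
case: k => n; first exact: e2pi_nat.
by rewrite NegzE rmorphN /= e2piN e2pi_nat conjc1.
Qed.

Lemma e2piDint t (k : int) : e2pi (t + k%:~R) = e2pi t.
Proof. by rewrite e2piD e2pi_int mulr1. Qed.

(** The fractional part u of t satisfies cos(2 pi u) = 1, so sin(pi u) = 0 by the double-angle
    formula; since sin is positive on (0, pi), u vanishes. *)
Lemma e2pi_eq1 t : e2pi t = 1 -> exists k : int, t = k%:~R.
Proof.
move=> et; exists (Num.floor t).
have /andP[] := floor_itv t; set k := Num.floor t => kt tk.
have : e2pi (t - k%:~R) = 1 by rewrite -mulrNz e2piDint.
have u0 : 0 <= t - k%:~R by rewrite subr_ge0.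
have u1 : t - k%:~R < 1 by rewrite ltrBlDr addrC -[1]/(1%:~R) -intrD.
move: u0 u1; set u := t - _ => u0 u1 [+ _].
have -> : 2 * pi * u = (pi * u) *+ 2 by ring.
rewrite cos_mulr2n cos2sin2 => h.
have s0 : sin (pi * u) = 0.
  apply/eqP; rewrite -sqrf_eq0; apply/eqP.
  by move: h; rewrite -mulr_natr => h; lra.
apply/eqP; rewrite -subr_eq0 -/u; apply: contraTT isT => un0 /=.
have : 0 < sin (pi * u).
  have ugt0 : 0 < u by rewrite lt_neqAle eq_sym un0.
  apply: sin_gt0_pi; apply/andP; split; first by rewrite mulr_gt0 // pi_gt0.
  by rewrite gtr_pMr // pi_gt0.
by rewrite s0 ltxx.
Qed.

(** The squared modulus as an element of [R]: it is multiplicative and needs no square root. *)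
Definition nsq z : R := complex.Re z ^+ 2 + complex.Im z ^+ 2.

Lemma nsq_ge0 z : 0 <= nsq z.
Proof. by rewrite addr_ge0 ?sqr_ge0. Qed.

Lemma nsqM z w : nsq (z * w) = nsq z * nsq w.
Proof. by case: z w => a b [c d]; rewrite /nsq /=; ring. Qed.

Lemma nsq1 : nsq 1 = 1.
Proof. by rewrite /nsq /= expr1n expr0n addr0. Qed.

Lemma nsq0 : nsq 0 = 0.
Proof. by rewrite /nsq /= !expr0n addr0. Qed.

Lemma nsq_eq0 z : nsq z = 0 -> z = 0.
Proof.
case: z => a b /eqP; rewrite /nsq /= paddr_eq0 ?sqr_ge0 // !sqrf_eq0.
by move=> /andP[/eqP -> /eqP ->].
Qed.

Lemma nsq_conj z : nsq z^*%C = nsq z.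
Proof. by case: z => a b; rewrite /nsq /= sqrrN. Qed.

Lemma mul_conj z : z * z^*%C = (nsq z)%:C%C.
Proof. by case: z => a b; rewrite /nsq; simpc; congr (_ +i* _)%C; ring. Qed.

Lemma normcE_nsq z : ComplexField.Normc.normc z = Num.sqrt (nsq z).
Proof. by case: z. Qed.

Lemma nsq_e2pi t : nsq (e2pi t) = 1.
Proof. by rewrite /nsq cos2Dsin2. Qed.

Lemma continuous_e2piRe : continuous (fun t => complex.Re (e2pi t) : R).
Proof.
move=> t; apply: (@continuous_comp _ _ _ ( *%R (2 * pi)) cos).
  exact: mulrl_continuous.
exact: continuous_cos.
Qed.

Lemma continuous_e2piIm : continuous (fun t => complex.Im (e2pi t) : R).
Proof.
move=> t; apply: (@continuous_comp _ _ _ ( *%R (2 * pi)) sin).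
  exact: mulrl_continuous.
exact: continuous_sin.
Qed.

End Exponential.

(** * The transfer operator *)

(** The cycle condition with the division by N cleared, so that it lives in the integers;
    [eta_cycleP] passes to the rational form. *)
Definition eta_cycle (N : int) (S : {fset int}) : Prop :=
  exists (m : nat) (s eta : nat -> int),
     [/\ (1 <= m)%N,
         forall j, (j < m)%N -> s j \in S /\ eta j != 0,
         eta m = eta 0%N,
         s m = s 0%N &
         forall j, (j < m)%N -> N * eta j.+1 = eta j + s j].

(** Base-N expansions with n digits in S, lowest digit first. Once 0 is a digit these lists grow
    with n and exhaust Lambda. *)
Fixpoint digit_sums (N : int) (S : {fset int}) (n : nat) : seq int :=
  if n is n'.+1 then [seq s + N * l | s <- S, l <- digit_sums N S n'] else [:: 0].

Lemma cvg_sumr (R : realType) (I T : Type) (F : set_system T) (r : seq I)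
    (f : I -> T -> R) (l : I -> R) : Filter F ->
  (forall i, f i x @[x --> F] --> l i) ->
  \sum_(i <- r) f i x @[x --> F] --> \sum_(i <- r) l i.
Proof. by move=> FF fl; apply: cvg_big => //; exact: add_continuous. Qed.

(** * Transfer operator with weight [p] (later |m_D|^2) and refinable function [g] (later
    |mu^|^2) *)

Section Transfer.
Variables (R : realType) (N : int) (S : {fset int}) (p g : R -> R).
Hypothesis N_gt1 : 1 < `|N|.
Hypothesis S0 : 0 \in S.
Hypothesis p_ge0 : forall x, 0 <= p x.
Hypothesis p_per : forall (x : R) (k : int), p (x + k%:~R) = p x.
Hypothesis p_sum : forall x : R, \sum_(s <- S) p ((x + s%:~R) / N%:~R) = 1.
Hypothesis p_eq1 : forall x, p x = 1 -> exists k : int, x = k%:~R.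
Hypothesis g_ge0 : forall x, 0 <= g x.
Hypothesis g_le1 : forall x, g x <= 1.
Hypothesis g0 : g 0 = 1.
Hypothesis gE : forall x, g x = p (x / N%:~R) * g (x / N%:~R).

Definition tau (s : int) (x : R) : R := (x + s%:~R) / N%:~R.

Definition transfer (h : R -> R) (x : R) : R :=
  \sum_(s <- S) p (tau s x) * h (tau s x).

Lemma N_neq0 : N%:~R != 0 :> R.
Proof. by rewrite intr_eq0 -normr_gt0 (lt_trans _ N_gt1). Qed.

Lemma p_int (k : int) : p k%:~R = 1.
Proof. by move: (gE 0); rewrite mul0r g0 mulr1 -(p_per 0 k) add0r. Qed.

(** The weights of the branches at x are nonnegative with sum 1, so a branch of weight 1 leaves
    nothing for the others. *)
Lemma p_branch0 x s t : s \in S -> t \in S -> s != t ->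
  p (tau t x) = 1 -> p (tau s x) = 0.
Proof.
move=> sS tS st pt.
have := p_sum x; rewrite (big_rem t) //= -[X in X + _]/(p (tau t x)) pt.
rewrite -[X in _ = X]addr0 => /addrI.
have srem : s \in rem t (enum_fset S).
  by rewrite (mem_rem_uniq _ (fset_uniq S)) inE st.
rewrite (big_rem s) //= -/(tau s x) => /eqP.
by rewrite paddr_eq0 ?sumr_ge0 // => /andP[/eqP ->].
Qed.

(** From the point -t the branch t leads to 0, where [p] is 1; hence the branch s has weight 0
    there. *)
Lemma p_diff0 s t : s \in S -> t \in S -> s != t ->
  p ((s - t)%:~R / N%:~R) = 0.
Proof.
move=> sS tS st; have := @p_branch0 (- t%:~R) s t sS tS st.
rewrite /tau addNr mul0r -[0]/(0%:~R) p_int => /(_ erefl).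
by rewrite intrD rmorphN /= addrC.
Qed.

(** Distinct digits are incongruent modulo N: otherwise (s - t) / N would be an integer, and [p]
    would take there both the value 1 and, by [p_diff0], the value 0. *)
Lemma digit_inj s t a b : s \in S -> t \in S -> s + N * a = t + N * b ->
  s = t /\ a = b.
Proof.
move=> sS tS e; have N0 : N != 0 by rewrite -normr_gt0 (lt_trans _ N_gt1).
have [st|st] := eqVneq s t.
  by move: e; rewrite st => /addrI /(mulfI N0).
have := p_diff0 sS tS st.
have -> : s - t = N * (b - a).
  by rewrite mulrBr -[s](addrK (N * a)) e; ring.
by rewrite intrM mulrAC mulfV ?N_neq0 // mul1r p_int => /eqP; rewrite oner_eq0.
Qed.

Lemma digit_sums_uniq n : uniq (digit_sums N S n).
Proof.
elim: n => // n IHn /=; apply: allpairs_uniq => //; first exact: fset_uniq.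
move=> [s a] [t b] /allpairsP[[s' a'] [/= sS _ [-> ->]]].
move=> /allpairsP[[t' b'] [/= tS _ [-> ->]]] /=.
by move=> /(digit_inj sS tS)[-> ->].
Qed.

Lemma digit_sums0 n : 0 \in digit_sums N S n.
Proof.
elim: n => [|n IHn]; first by rewrite inE.
by apply/allpairsP; exists (0, 0); split=> //=; rewrite mulr0 addr0.
Qed.

Lemma digit_sumsS n l : l \in digit_sums N S n -> l \in digit_sums N S n.+1.
Proof.
elim: n l => [|n IHn] l; first by rewrite inE => /eqP ->; exact: digit_sums0.
move=> /allpairsP[[s a] /= [sS aL ->]].
by apply/allpairsP; exists (s, a); split => //; exact: IHn.
Qed.

Lemma digit_sums_sub n m l : (n <= m)%N -> l \in digit_sums N S n -> l \in digit_sums N S m.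
Proof.
move=> /subnKC <-; elim: (m - n)%N => [|k IH]; first by rewrite addn0.
by rewrite addnS => /IH /digit_sumsS.
Qed.

(** In [gE] the periodic factor [p] only sees the difference of the lowest digits. It vanishes when
    these differ; otherwise they cancel and the remaining digits are compared. *)
Lemma g_orth n l l' : l \in digit_sums N S n -> l' \in digit_sums N S n -> l != l' ->
  g (l - l')%:~R = 0.
Proof.
elim: n l l' => [|n IHn] l l'.
  by rewrite !inE => /eqP -> /eqP ->; rewrite eqxx.
move=> /allpairsP[[s a] /= [sS aL ->]] /allpairsP[[t b] /= [tS bL ->]] ne.
have -> : s + N * a - (t + N * b) = (s - t) + N * (a - b) by ring.
rewrite gE intrD mulrDl intrM mulrAC mulfV ?N_neq0 // mul1r p_per.
have [st|st] := eqVneq s t; last by rewrite p_diff0 ?mul0r.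
rewrite st subrr mul0r add0r IHn ?mulr0 //.
by apply: contraNneq ne => ->; rewrite st.
Qed.

(** The integer is eta_0. All the weight at a point of the cycle sits on the branch that continues
    the cycle, so expanding g(eta_0 + l) digit by digit either meets a factor 0 or ends at a value
    of [g] on the cycle, which is 0 as well. *)
Lemma cycle_g0 : eta_cycle N S ->
  exists k : int, forall n l, l \in digit_sums N S n -> g (k + l)%:~R = 0.
Proof.
move=> [m [s [eta [m_gt0 cS etam sm rec]]]].
(* The cycle is continued periodically to all indices. *)
pose e j := eta (j %% m)%N; pose u j := s (j %% m)%N.
have uS j : u j \in S by apply: (cS _ _).1; rewrite ltn_mod.
have e0 j : e j != 0 by apply: (cS _ _).2; rewrite ltn_mod.
have eu j : N * e j.+1 = e j + u j.
  rewrite -rec ?ltn_mod //; congr (N * _); rewrite /e -addn1 -modnDml addn1.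
  have := ltn_mod j m; rewrite m_gt0 leq_eqVlt => /orP[/eqP ->|/modn_small -> //].
  by rewrite modnn etam.
(* Nonzero digits recur: if all digits from k on were 0, then |e k| = |e (k + m)| |N|^m = |e k|
   |N|^m over a full period, although e k is nonzero. *)
have unz k : exists2 j, (k <= j)%N & u j != 0.
  apply: contrapT => nex.
  have u0 j : (k <= j)%N -> u j = 0.
    by move=> kj; apply/eqP; apply: contrapT => /negP uj; apply: nex; exists j.
  have dec i : `|e (k + i)%N| * `|N| ^+ i = `|e k|.
    elim: i => [|i IHi]; first by rewrite addn0 mulr1.
    rewrite -IHi exprS mulrA addnS [_ * `|N|]mulrC -normrM eu.
    by rewrite u0 ?leq_addr // addr0.
  have ekm : e (k + m)%N = e k by rewrite /e modnDr.
  have := dec m; rewrite ekm => /eqP.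
  rewrite -subr_eq0 -[X in _ - X]mulr1 -mulrBr mulf_eq0 normr_eq0 (negbTE (e0 k)).
  by rewrite subr_eq0 /= gt_eqF // exprn_egt1 // -lt0n.
have eR k : ((e k)%:~R + (u k)%:~R) / N%:~R = (e k.+1)%:~R :> R.
  by rewrite -intrD -eu intrM mulrAC mulfV ?N_neq0 // mul1r.
(* The branch u_k leads to an integer, hence has weight 1. *)
have pbr k t : t \in S -> t != u k -> p (tau t (e k)%:~R) = 0.
  move=> tS tu; apply: (@p_branch0 _ _ (u k)) => //.
  by rewrite /tau eR p_int.
(* [gE] follows the branch 0. This stays on the cycle as long as the digit is 0, and has weight 0 as
   soon as a nonzero digit is met; induction on the distance d to such a digit. *)
have gbase k : g (e k)%:~R = 0.
  have [j kj uj] := unz k; move: kj => /subnKC; move: (j - k)%N => d dE.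
  elim: d k dE => [|d IHd] k dE.
    rewrite gE -[X in p (X / _)]addr0 (pbr k 0 S0) ?mul0r //.
    by rewrite eq_sym -[k]addn0 dE.
  have [uk|uk] := eqVneq (u k) 0; last first.
    by rewrite gE -[X in p (X / _)]addr0 (pbr k 0 S0) ?mul0r // eq_sym.
  rewrite gE -[X in g (X / _)]addr0 -[X in _ + X]/((0 : int)%:~R) -uk eR IHd ?mulr0 //.
  by rewrite addSnnS.
(* The start of the cycle is generalized, since each digit of l moves it by one index. *)
exists (e 0%N) => n l; move: 0%N => k.
elim: n l k => [|n IHn] l k; first by rewrite inE => /eqP ->; rewrite addr0.
move=> /allpairsP[[t a] /= [tS aL ->]].
rewrite gE addrA intrD mulrDl intrM [_ * a%:~R / _]mulrAC mulfV ?N_neq0 // mul1r p_per.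
rewrite intrD; have [tu|tu] := eqVneq t (u k); last by rewrite (pbr k t) ?mul0r.
by rewrite tu eR -intrD IHn ?mulr0.
Qed.

(** * Iterates of the transfer operator and their limit Q *)

Lemma tauD s x (l : int) : tau s x + l%:~R = (x + (s + N * l)%:~R) / N%:~R.
Proof.
by rewrite intrD intrM addrA mulrDl [_ * l%:~R / _]mulrAC mulfV ?N_neq0 // mul1r.
Qed.

(** By periodicity the weight p(tau s x) equals p(tau s x + l), which is exactly the factor that
    [gE] extracts from g(x + s + N l). *)
Lemma iter_transferE n x :
  iter n transfer g x = \sum_(l <- digit_sums N S n) g (x + l%:~R).
Proof.
elim: n x => [|n IHn] x; first by rewrite big_seq1 addr0.
rewrite iterS /transfer /= big_allpairs_dep; apply: eq_bigr => s _.
rewrite IHn mulr_sumr; apply: eq_bigr => l _.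
by rewrite -(p_per _ l) tauD -gE.
Qed.

(** Iterates at x only read values at points reached from x by branches, so a comparison on a set
    [K] stable under the branches is enough; the weights are nonnegative. *)
Lemma iter_transfer_le (K : R -> Prop) (h h' : R -> R) n :
  (forall s x, s \in S -> K x -> K (tau s x)) ->
  (forall x, K x -> h x <= h' x) ->
  forall x, K x -> iter n transfer h x <= iter n transfer h' x.
Proof.
move=> KS hh'; elim: n => // n IHn x Kx; rewrite !iterS /transfer.
rewrite big_seq [leRHS]big_seq; apply: ler_sum => s sS.
by rewrite ler_wpM2l // IHn //; exact: KS.
Qed.

Lemma iter_transferD h h' n x :
  iter n transfer (fun y => h y + h' y) x = iter n transfer h x + iter n transfer h' x.
Proof.
elim: n x => // n IHn x; rewrite !iterS /transfer -big_split /=.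
by apply: eq_bigr => s _; rewrite IHn mulrDr.
Qed.

Lemma iter_transferZ c h n x :
  iter n transfer (fun y => c * h y) x = c * iter n transfer h x.
Proof.
elim: n x => // n IHn x; rewrite !iterS /transfer mulr_sumr.
by apply: eq_bigr => s _; rewrite IHn mulrCA.
Qed.

Lemma iter_transfer_cst c n x : iter n transfer (fun=> c) x = c.
Proof.
elim: n x => // n IHn x; rewrite iterS /transfer.
by under eq_bigr do rewrite IHn; rewrite -mulr_suml p_sum mul1r.
Qed.

Lemma iter_transfer_cvg (h : nat -> R -> R) (h' : R -> R) n :
  (forall x, h j x @[j --> \oo] --> h' x) ->
  forall x, iter n transfer (h j) x @[j --> \oo] --> iter n transfer h' x.
Proof.
move=> hh'; elim: n => // n IHn x; rewrite iterS.
under eq_fun do rewrite iterS.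
apply: cvg_sumr => s; apply: cvgM; [exact: cvg_cst|exact: IHn].
Qed.

Lemma transfer_ge0_branch h x : (forall y, 0 <= h y) ->
  p (x / N%:~R) * h (x / N%:~R) <= transfer h x.
Proof.
move=> h0; have -> : x / N%:~R = tau 0 x by rewrite /tau addr0.
by rewrite /transfer (big_rem 0) //= lerDl sumr_ge0 // => s _; rewrite mulr_ge0.
Qed.

(** Only the branch 0 is kept at each of the n steps; the product of its weights with the value of
    [g] at x / N^n is g(x) by [gE]. *)
Lemma iter_transfer_ge_branch n (u : R -> R) x : (forall y, 0 <= u y) ->
  g x * u (x / N%:~R ^+ n) <= iter n transfer (fun y => g y * u y) x.
Proof.
move=> u0; elim: n x => [|n IHn] x; first by rewrite expr0 divr1.
rewrite iterS; apply: le_trans (transfer_ge0_branch _ _); last first.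
  by move=> y; apply: le_trans (IHn y); rewrite mulr_ge0.
rewrite gE -mulrA ler_wpM2l //; apply: le_trans (IHn _).
by rewrite exprS invfM mulrA.
Qed.

(** By [gE] the branch 0 alone contributes [g] to its transfer, so g <= R g, and R^n preserves the
    inequality. *)
Lemma iter_transfer_nd x : nondecreasing_seq (fun n => iter n transfer g x).
Proof.
apply/nondecreasing_seqP => n; rewrite iterSr.
apply: (@iter_transfer_le (fun=> True)) => // y _.
by rewrite gE transfer_ge0_branch.
Qed.

Lemma iter_transfer_le1 n x : iter n transfer g x <= 1.
Proof.
rewrite -[leRHS](iter_transfer_cst 1 n x).
exact: (@iter_transfer_le (fun=> True)).
Qed.

Definition limQ x := lim (iter n transfer g x @[n --> \oo]).

Lemma limQ_cvg x : iter n transfer g x @[n --> \oo] --> limQ x.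
Proof.
apply: nondecreasing_is_cvgn; first exact: iter_transfer_nd.
by exists 1 => _ [n _ <-]; exact: iter_transfer_le1.
Qed.

Lemma iter_le_limQ n x : iter n transfer g x <= limQ x.
Proof. apply: (nondecreasing_cvgn_le (iter_transfer_nd x)); apply: limQ_cvg. Qed.

Lemma limQ_le1 x : limQ x <= 1.
Proof.
apply: limr_le; first by apply/cvg_ex; exists (limQ x); exact: limQ_cvg.
by apply: nearW => n; exact: iter_transfer_le1.
Qed.

(** R is a finite sum, so it commutes with pointwise limits: R(R^n g) tends to R Q, and to Q as a
    shifted sequence. *)
Lemma limQ_harmonic n x : iter n transfer limQ x = limQ x.
Proof.
elim: n x => // n IHn x; rewrite iterS.
have -> : iter n transfer limQ = limQ by apply/funext.
have := @iter_transfer_cvg (fun n => iter n transfer g) limQ 1%N limQ_cvg x.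
move=> h; have h2 : iter j.+1 transfer g x @[j --> \oo] --> limQ x.
  by rewrite (cvg_shiftS (fun j => iter j transfer g x)); exact: limQ_cvg.
exact: (cvg_unique _ h h2).
Qed.

Hypothesis g_cont : continuous g.

Lemma invN_lt1 : `|(N%:~R : R)^-1| < 1.
Proof.
by rewrite normfV invf_lt1 ?normr_gt0 ?N_neq0 // -intr_norm -[1]/(1%:~R) ltr_int.
Qed.

Lemma div_expN_cvg0 (x : R) : x / N%:~R ^+ n @[n --> \oo] --> (0 : R).
Proof.
rewrite -[X in _ --> X](mulr0 x); apply: cvgM; first exact: cvg_cst.
under eq_fun do rewrite -exprVn.
exact/cvg_expr/invN_lt1.
Qed.

(* c(1 - Q) = R^n(c(1 - Q)) <= R^n(Q - Q^2) = Q - R^n(Q^2), and R^(k+j)(Q^2) is at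
   least R^k(g * g(. / N^j)), which tends to R^k g as j grows since g(0) = 1. *)
Lemma limQ_eq1 (c : R) (K : R -> Prop) : 0 < c ->
  (forall s x, s \in S -> K x -> K (tau s x)) ->
  (forall x, K x -> c <= limQ x) ->
  forall x, K x -> limQ x = 1.
Proof.
move=> c0 KS Kc x Kx.
have gQ y : g y <= limQ y by exact: (iter_le_limQ 0).
have main n : c * (1 - limQ x) <= limQ x - iter n transfer (fun y => limQ y ^+ 2) x.
  have e1 : iter n transfer (fun y => c * (1 + -1 * limQ y)) x = c * (1 - limQ x).
    by rewrite iter_transferZ iter_transferD iter_transfer_cst iter_transferZ
               limQ_harmonic mulN1r.
  have e2 : iter n transfer (fun y => limQ y + -1 * limQ y ^+ 2) x =
      limQ x - iter n transfer (fun y => limQ y ^+ 2) x.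
    by rewrite iter_transferD iter_transferZ limQ_harmonic mulN1r.
  rewrite -e1 -e2. apply: (iter_transfer_le n KS) => // y Ky.
  by rewrite mulN1r mulN1r; have := Kc _ Ky; have := limQ_le1 y; nra.
have sq k j : iter k transfer (fun y => g y * g (y / N%:~R ^+ j)) x <=
    iter (k + j) transfer (fun y => limQ y ^+ 2) x.
  rewrite iterD; apply: (@iter_transfer_le (fun=> True)) => // y _.
  apply: le_trans (iter_transfer_ge_branch _ _ _) _ => //.
  apply: (@iter_transfer_le (fun=> True)) => // z _.
  by rewrite expr2 ler_pM.
have lim1 k : iter k transfer g x <= limQ x - c * (1 - limQ x).
  have : iter k transfer (fun y => g y * g (y / N%:~R ^+ j)) x @[j --> \oo] -->
      iter k transfer g x.
    apply: iter_transfer_cvg => y; rewrite -[X in _ --> X]mulr1.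
    apply: cvgM; first exact: cvg_cst.
    by rewrite -[X in _ --> X]g0; apply: continuous_cvg; [exact: g_cont|exact: div_expN_cvg0].
  move=> h; rewrite -(cvg_lim _ h) //; apply: limr_le; first by apply/cvg_ex; exists (iter k transfer g x).
  apply: nearW => j; apply: le_trans (sq k j) _.
  by have := main (k + j)%N; lra.
(* Here k tends to infinity; since c > 0 and Q <= 1, the inequality forces Q = 1. *)
have : limQ x <= limQ x - c * (1 - limQ x).
  by apply: limr_le; [by apply/cvg_ex; exists (limQ x); exact: limQ_cvg|apply: nearW].
have := limQ_le1 x; nra.
Qed.

(* The words of n branches of positive weight starting at x; the word encoded by l
   ends at (x + l) / N^n. *)
Fixpoint paths (n : nat) (x : R) : seq int :=
  if n is n'.+1 then
    [seq s + N * l | s <- [seq s <- S | p (tau s x) != 0], l <- paths n' (tau s x)]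
  else [:: 0].

Lemma paths_uniq n x : uniq (paths n x).
Proof.
elim: n x => // n IHn x /=; apply: allpairs_uniq_dep => //.
  exact/filter_uniq/fset_uniq.
move=> _ _ /allpairsPdep[s [a [sS aP ->]]] /allpairsPdep[t [b [tS bP ->]]] /=.
move: sS tS; rewrite !mem_filter => /andP[_ sS] /andP[_ tS].
by move=> /(digit_inj sS tS)[-> ->].
Qed.

Lemma size_pathsS n x :
  size (paths n.+1 x) = (\sum_(s <- S | p (tau s x) != 0%R) size (paths n (tau s x)))%N.
Proof. by rewrite /= size_allpairs_dep sumnE big_map big_filter. Qed.

Lemma branch_neq0 x : exists2 s, s \in S & p (tau s x) != 0.
Proof.
apply: contrapT => nex; have := p_sum x; rewrite big_seq big1 => [/eqP|s sS].
  by rewrite eq_sym oner_eq0.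
by apply/eqP; apply: contrapT => /negP ps; apply: nex; exists s.
Qed.

Lemma size_paths_gt0 n x : (0 < size (paths n x))%N.
Proof.
elim: n x => // n IHn x; have [s sS ps] := branch_neq0 x.
by rewrite size_pathsS (big_rem s) //= ps ltn_addr.
Qed.

(** Every endpoint has a branch of positive weight, so no word dies out. *)
Lemma size_paths_le n x : (size (paths n x) <= size (paths n.+1 x))%N.
Proof.
elim: n x => [|n IHn] x; first exact: size_paths_gt0.
by rewrite 2!size_pathsS; apply: leq_sum.
Qed.

(** * Finite sets stable under the branches of positive weight *)

Section FiniteInvariantSet.
Variable zs : seq R.
Hypothesis zsI : forall x s, x \in zs -> s \in S -> p (tau s x) != 0 -> tau s x \in zs.

Lemma paths_end n x l : x \in zs -> l \in paths n x ->
  (x + l%:~R) / N%:~R ^+ n \in zs.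
Proof.
elim: n x l => [|n IHn] x l xz.
  by rewrite inE => /eqP ->; rewrite addr0 expr0 divr1.
move=> /allpairsPdep[s [a [+ aP ->]]]; rewrite mem_filter => /andP[ps sS].
by rewrite exprS invfM mulrA -tauD; apply: IHn => //; exact: zsI.
Qed.

(** Distinct words end at distinct points (x + l) / N^n, all of which lie in [zs]. *)
Lemma size_paths_bound n x : x \in zs -> (size (paths n x) <= size zs)%N.
Proof.
move=> xz; rewrite -(size_map (fun l => (x + l%:~R) / N%:~R ^+ n)).
apply: uniq_leq_size; last by move=> _ /mapP[l lP ->]; exact: paths_end.
rewrite map_inj_uniq ?paths_uniq // => a b.
move=> /(mulIf (invr_neq0 (expf_neq0 n N_neq0))) /addrI /intr_inj.
exact.
Qed.

(** The total count over [zs] is nondecreasing in n and at most (size zs)^2, so it stalls at some n;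
    each count being nondecreasing, all of them stall there together. *)
Lemma size_paths_stable : exists n, forall x, x \in zs ->
  size (paths n.+1 x) = size (paths n x).
Proof.
pose T n := (\sum_(x <- zs) size (paths n x))%N.
have TS n : (T n <= T n.+1)%N by apply: leq_sum => x _; exact: size_paths_le.
have [n Tn] : exists n, T n.+1 = T n.
  apply: contrapT => nex.
  have Tlow n : (n <= T n)%N.
    elim: n => // n IHn; apply: leq_ltn_trans IHn _; rewrite ltn_neqAle TS andbT.
    by apply/eqP => e; apply: nex; exists n.
  have Tup n : (T n <= size zs * size zs)%N.
    rewrite /T big_seq; apply: (@leq_trans (\sum_(x <- zs | x \in zs) size zs)%N); first apply: leq_sum.
      by move=> x xz; exact: size_paths_bound.
    by rewrite -big_seq big_const_seq count_predT iter_addn_0.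
  by have := leq_trans (Tlow (size zs * size zs).+1) (Tup _); rewrite ltnn.
exists n => x xz; apply/eqP; rewrite eqn_leq size_paths_le andbT leqNgt.
apply/negP => lt; have : (T n < T n.+1)%N; last by rewrite Tn ltnn.
rewrite /T (big_rem x) // [X in (_ < X)%N](big_rem x) //= -addSn leq_add //.
by apply: leq_sum => y _; exact: size_paths_le.
Qed.

(* A stable path count b is positive and b(x) is the sum of b over the successors
   of x; so a point where b is minimal has exactly one successor. *)
Lemma exists_rigid : zs != [::] -> exists M : R -> Prop,
  [/\ exists x, M x, forall x, M x -> x \in zs &
      forall x, M x -> exists2 s, s \in S & M (tau s x) /\ p (tau s x) = 1].
Proof.
move=> zs0; have [n stab] := size_paths_stable.
pose b x := size (paths n x).
have bE x : x \in zs -> b x = (\sum_(s <- S | p (tau s x) != 0%R) b (tau s x))%N.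
  by move=> xz; rewrite {1}/b -stab // size_pathsS.
have exb : exists k, has (fun x => b x == k) zs.
  case: zs zs0 => // x ? _; exists (b x); by rewrite /= eqxx.
have [k /hasP[x1 x1z /eqP bx1] kmin] := ex_minnP exb.
(* The points of minimal count: the unique successor of such a point carries its whole count k,
   hence is again minimal. *)
exists (fun x => x \in zs /\ b x = k); split.
- by exists x1.
- by move=> x [].
- move=> x [xz bx]; have [s sS ps] := branch_neq0 x; exists s => //.
  have tz : tau s x \in zs by exact: zsI.
  have bt : (k <= b (tau s x))%N by apply: kmin; apply/hasP; exists (tau s x).
  have := bE _ xz; rewrite (big_rem s) //= ps bx => kE.
  have bs : b (tau s x) = k.
    by apply/eqP; rewrite eqn_leq bt andbT kE leq_addr.
  split; first by [].
  have := p_sum x; rewrite (big_rem s) //= -/(tau s x) big_seq big1 ?addr0 //.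
  move=> t ts; apply/eqP; apply: contraT => pt.
  move: kE; rewrite bs -[X in X = _]addn0 => /addnI /esym /eqP.
  rewrite (big_rem t) //= pt addn_eq0 => /andP[+ _].
  by rewrite eqn0Ngt size_paths_gt0.
Qed.

(** Inside the rigid set one follows the branches of weight 1. Their endpoints are integers by
    [p_eq1], they are nonzero because 0 is not in [zs], and the pigeonhole principle closes the
    orbit. *)
Lemma exists_cycle : zs != [::] -> 0 \notin zs -> eta_cycle N S.
Proof.
move=> /exists_rigid[M [[x1 Mx1] Mz Mstep]] z0.
have /choice[f fP] : forall x, exists s : int,
    M x -> [/\ s \in S, M (tau s x) & p (tau s x) = 1].
  move=> x; have [Mx|nMx] := pselect (M x); last by exists 0.
  by have [s sS [Ms ps]] := Mstep _ Mx; exists s.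
pose orb k := iter k (fun x => tau (f x) x) x1.
have Mo k : M (orb k) by elim: k => // k IHk; have [] := fP _ IHk.
have /choice[e eP] : forall k, exists z : int, orb k.+1 = z%:~R.
  by move=> k; apply: p_eq1; have [] := fP _ (Mo k).
have [i [j [ij jlt oij]]] : exists i j, [/\ (i < j)%N, (j < (size zs).+1)%N & orb i = orb j].
  have : ~~ uniq [seq orb k | k <- iota 0 (size zs).+1].
    apply/negP => /uniq_leq_size sub.
    have /sub : {subset [seq orb k | k <- iota 0 (size zs).+1] <= zs}.
      by move=> _ /mapP[k _ ->]; exact: Mz.
    by rewrite size_map size_iota ltnn.
  move=> /(uniqPn x1)[i [j [ij]]]; rewrite size_map size_iota => jlt.
  rewrite !(nth_map 0%N) ?size_iota ?(ltn_trans ij) // !nth_iota ?(ltn_trans ij) //.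
  by exists i, j.
have shift k : orb (i + k)%N = orb (j + k)%N by rewrite ![(_ + k)%N]addnC /orb !iterD -!/(orb _) oij.
(* The indices are shifted by one: the starting point [orb 0] may fail to be an integer, while
   [orb k.+1] is the integer [e k]. *)
exists (j - i)%N, (fun k => f (orb (i + k).+1)), (fun k => e (i + k)%N).
rewrite subnKC ?(ltnW ij) // addn0; split.
- by rewrite subn_gt0.
- move=> k _; split; first by have [] := fP _ (Mo (i + k).+1).
  apply: contraNneq z0 => e0; rewrite -[0]/((0 : int)%:~R) -e0 -eP.
  exact: Mz.
- by apply: (@intr_inj R); rewrite -!eP -[j.+1]addn1 -[i.+1]addn1 shift.
- by rewrite -[j.+1]addn1 -[i.+1]addn1 shift.
- move=> k _; apply: (@intr_inj R); rewrite addnS intrM intrD -!eP.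
  rewrite -[orb (i + k).+2]/(tau (f (orb (i + k).+1)) (orb (i + k).+1)).
  by rewrite mulrC divfK // N_neq0.
Qed.

End FiniteInvariantSet.

(** * Without a cycle, Q is identically 1 *)

Hypothesis g_zeros : forall B : R, exists zs : seq R,
  forall x, `|x| <= B -> g x = 0 -> x \in zs.

(** [B0] dominates every |s|, and |N| >= 2, so |x + s| / |N| <= 2B / 2. *)
Lemma tau_interval : exists2 B0 : R, 0 <= B0 & forall B, B0 <= B ->
  forall s x, s \in S -> `|x| <= B -> `|tau s x| <= B.
Proof.
exists (\sum_(s <- S) `|(s%:~R : R)|); first by rewrite sumr_ge0.
move=> B BB s x sS xB; rewrite /tau normrM normfV.
have N2 : 2 <= `|N%:~R : R|.
  by rewrite -intr_norm -[2]/(2%:~R) ler_int.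
rewrite ler_pdivrMr; last by apply: lt_le_trans N2; rewrite ltr0n.
have : `|s%:~R : R| <= B.
  by apply: le_trans BB; rewrite (big_rem s) //= lerDl sumr_ge0.
have := ler_normD x s%:~R; have := normr_ge0 x; nra.
Qed.

(** In a stable interval the zeros of Q are zeros of [g], hence finitely many. Harmonicity with
    nonnegative terms makes them stable under the branches of positive weight, and 0 is not among
    them because Q(0) >= g(0) = 1; so [exists_cycle] applies. *)
Lemma limQ_gt0 : ~ eta_cycle N S -> forall x, 0 < limQ x.
Proof.
move=> nocycle x0; rewrite lt_neqAle (le_trans (g_ge0 x0) (iter_le_limQ 0 x0)) andbT.
apply/eqP => /esym Q0; apply: nocycle.
have [B0 B00 /(_ (Num.max B0 `|x0|))] := tau_interval.
rewrite le_max lexx => /(_ isT); set B := Num.max _ _ => KB.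
have [zs0 zs0P] := g_zeros B.
pose Z x := limQ x = 0 /\ `|x| <= B.
have Z0 x : Z x -> x \in zs0.
  move=> [Qx xB]; apply: zs0P => //; apply/eqP; rewrite eq_le g_ge0 andbT -Qx.
  exact: (iter_le_limQ 0).
pose zs := [seq x <- zs0 | `[<Z x>]].
have memz x : (x \in zs) <-> Z x.
  rewrite mem_filter; split=> [/andP[/asboolP]//|Zx].
  by rewrite Z0 // andbT; apply/asboolP.
apply: (@exists_cycle zs).
- move=> x s /memz[Qx xB] sS ps; apply/memz; split; last exact: KB.
  have := limQ_harmonic 1 x; rewrite /= Qx /transfer (big_rem s) //= => /eqP.
  have Qge0 y : 0 <= limQ y by rewrite (le_trans (g_ge0 y) (iter_le_limQ 0 y)).
  rewrite paddr_eq0 ?mulr_ge0 ?sumr_ge0 // => [|i _]; last by rewrite mulr_ge0.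
  by rewrite mulf_eq0 (negbTE ps) /= => /andP[/eqP].
- have : x0 \in zs by apply/memz; split => //; rewrite le_max lexx orbT.
  by apply: contraTneq => ->.
- apply/negP => /memz[Q00 _]; have := iter_le_limQ 0 0.
  by rewrite /= g0 Q00 ler10.
Qed.

Lemma continuous_iter_transfer n : continuous (iter n transfer g).
Proof.
have -> : iter n transfer g = (fun x => \sum_(l <- digit_sums N S n) g (x + l%:~R)).
  by apply/funext => y; exact: iter_transferE.
move=> x; apply: (cvg_sumr (l := fun l : int => g (x + l%:~R))) => l.
apply: continuous_comp; last exact: g_cont.
by apply: cvgD; [exact: cvg_id|exact: cvg_cst].
Qed.

(** Q is positive and the supremum of the continuous R^n g, hence bounded below on a stable interval
    [-B, B] containing the given point; [limQ_eq1] concludes. *)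
Lemma no_cycle_limQ : ~ eta_cycle N S -> forall x, limQ x = 1.
Proof.
move=> nocycle x0.
have [B0 B00 /(_ (Num.max B0 `|x0|))] := tau_interval.
rewrite le_max lexx => /(_ isT); set B := Num.max _ _ => KB.
(* Compactness in near-covering form: as 1/(n+1) <= Q holds near each point for all large n, it
   holds on the whole interval for all large n. *)
have /compact_near_coveringP/(_ nat \oo (fun n x => n.+1%:R^-1 <= limQ x)) :=
  @segment_compact R (- B) B.
move=> /(_ _)[].
  move=> x _; have Qx := limQ_gt0 nocycle x.
  have [n0 Qn0] : exists n, 0 < iter n transfer g x.
    apply: contrapT => nex; suff : limQ x <= 0 by rewrite leNgt Qx.
    apply: limr_le; first by apply/cvg_ex; exists (limQ x); exact: limQ_cvg.
    by apply: nearW => n; rewrite leNgt; apply/negP => ?; apply: nex; exists n.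
  have near1 : \forall x' \near x, iter n0 transfer g x / 2 < iter n0 transfer g x'.
    have := @continuous_iter_transfer n0 x; move=> /cvgr_gt; apply.
    by rewrite ltr_pdivrMr // ltr_pMr // ltr1n.
  have near2 : \forall n \near \oo, n.+1%:R^-1 < iter n0 transfer g x / 2.
    by apply: near_infty_natSinv_lt (PosNum (divr_gt0 Qn0 _)).
  near=> x' n => /=.
  apply: ltW; apply: lt_le_trans (iter_le_limQ n0 _).
  apply: (@lt_trans _ _ (iter n0 transfer g x / 2)); first by near: n.
  by near: x'.
move=> n _ /(_ n (leqnn _)) Qlow.
apply: (@limQ_eq1 n.+1%:R^-1 (fun x => `|x| <= B)) => //.
  by move=> x; rewrite ler_norml => xB; apply: Qlow; rewrite /= in_itv.
by rewrite le_max lexx orbT.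
Unshelve. all: by end_near. Qed.

End Transfer.

(** * The mask *)

Section Mask.
Variables (R : realType) (D : {fset int}).

Lemma nsqE (z : R[i]) : (nsq z)%:C%C = z * Num.conj z.
Proof. by rewrite -mul_conj. Qed.

(** The enumeration of an image set need not follow that of [A]; sums over the two agree up to this
    permutation. *)
Lemma perm_imfset (T : choiceType) (f : int -> T) (A : {fset int}) :
  injective f -> perm_eq [fset f a | a in A] [seq f a | a <- A].
Proof.
move=> f_inj; apply: uniq_perm; rewrite ?fset_uniq ?map_inj_uniq ?fset_uniq //.
move=> x; apply/imfsetP/mapP => -[a aA ->]; by exists a.
Qed.

Definition mask_poly (x : R) : R[i] :=
  ((#|`D|%:R)^-1)%:C%C * \sum_(d <- D) e2pi (d%:~R * x).

Lemma mask_per x (k : int) : mask_poly (x + k%:~R) = mask_poly x.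
Proof.
rewrite /mask_poly; congr (_ * _); apply: eq_bigr => d _.
by rewrite mulrDr -intrM e2piDint.
Qed.

Hypothesis D0 : 0 \in D.

Lemma cardD_neq0 : #|`D|%:R != 0 :> R.
Proof. by rewrite pnatr_eq0 cardfs_eq0; apply/fset0Pn; exists 0. Qed.

(** The row vector v of the e(d x / N) / sqrt q has norm 1, and the entries of v M are the values of
    the mask at the points (x + s) / N. The unitary M preserves the norm. *)
Lemma compatible_mask_sum (N : int) (S : {fset int}) : N != 0 ->
  compatible_pair [fset (d%:~R / N%:~R : R) | d in D]
                  [fset (s%:~R : R) | s in S] ->
  forall x : R, \sum_(s <- S) nsq (mask_poly ((x + s%:~R) / N%:~R)) = 1.
Proof.
move=> N0 [].
have NR0 : (N%:~R)^-1 != 0 :> R by rewrite invr_neq0 // intr_eq0.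
have dinj : injective (fun d : int => d%:~R / N%:~R : R).
  by move=> a b /(mulIf NR0) /intr_inj.
have sinj : injective (fun s : int => s%:~R : R) by exact: intr_inj.
have pA := perm_imfset D dinj; have pB := perm_imfset S sinj.
move: pA pB; set A := [fset _ | d in D]; set B := [fset _ | s in S] => pA pB.
have -> : #|`A| = #|`D| by rewrite (perm_size pA) size_map.
set q := #|`D|; have sA : size A = q by rewrite (perm_size pA) size_map.
move=> sB /unitarymxP uU x.
pose c : R := (Num.sqrt (q%:R : R))^-1.
have cc : c * c = q%:R^-1 by rewrite -expr2 exprVn sqr_sqrtr.
pose v : 'rV[R[i]]_q := \row_j (c%:C%C * e2pi (A`_j * x)).
set M := (\matrix_(_, _) _) in uU.
have vM (k : 'I_q) : nsq ((v *m M) 0 k) = nsq ((q%:R^-1)%:C%C * \sum_(j < q) e2pi (A`_j * (x + B`_k))).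
  rewrite mxE mulr_sumr; congr (nsq _); apply: eq_bigr => j _.
  by rewrite !mxE mulrACA -rmorphM /= -/c cc -e2piD -mulrDr.
have maskE s : mask_poly ((x + s%:~R) / N%:~R) = (q%:R^-1)%:C%C * \sum_(j < q) e2pi (A`_j * (x + s%:~R)).
  rewrite /mask_poly; congr (_ * _).
  rewrite -(big_mkord xpredT (fun j => e2pi (A`_j * (x + s%:~R)))) -{1}sA.
  rewrite -(big_nth 0 xpredT (fun a => e2pi (a * (x + s%:~R)))).
  rewrite (perm_big _ pA) big_map; apply: eq_bigr => d _.
  by rewrite mulrAC mulrA.
under eq_bigr do rewrite maskE.
rewrite -(big_map (fun s : int => s%:~R : R) xpredT (fun b => nsq (_ * \sum_(j < q) e2pi (A`_j * (x + b))))).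
rewrite -(perm_big _ pB) /= (big_nth 0) -/(#|`B|) sB big_mkord.
under eq_bigr do rewrite -vM.
apply: (@complexI R); rewrite rmorph_sum /=.
(* The squared norm of v M as a 1 x 1 matrix product, where M M^* cancels. *)
transitivity (((v *m M) *m ((v *m M)^t*)%sesqui) 0 0).
  by rewrite mxE; apply: eq_bigr => k _; rewrite nsqE !mxE.
rewrite trmx_mul map_mxM mulmxA -[v *m M *m _]mulmxA uU mulmx1 mxE.
under eq_bigr => j _ do rewrite [X in _ * X]mxE [X in _ * _ X]mxE -nsqE !mxE nsqM nsq_e2pi mulr1.
rewrite -rmorph_sum /= sumr_const card_ord.
rewrite /nsq /= expr0n addr0 expr2 cc -[_ *+ q]mulr_natr mulVf //.
exact: cardD_neq0.
Qed.

Let q : R := #|`D|%:R.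

Lemma q_neq0 : q != 0. Proof. exact: cardD_neq0. Qed.

(* The variance of the unit vectors e(dx) about their mean is 1 - |mean|^2. *)
Lemma mask_eq1_const x : nsq (mask_poly x) = 1 -> forall d, d \in D -> e2pi (d%:~R * x) = 1.
Proof.
move=> m1; pose a d : R := complex.Re (e2pi (d%:~R * x)).
pose b d : R := complex.Im (e2pi (d%:~R * x)).
have ab d : a d ^+ 2 + b d ^+ 2 = 1 by rewrite -[LHS]/(nsq _) nsq_e2pi.
pose u := complex.Re (mask_poly x); pose w := complex.Im (mask_poly x).
have uw : u ^+ 2 + w ^+ 2 = 1 by exact: m1.
have sumE : \sum_(d <- D) e2pi (d%:~R * x) = q%:C%C * mask_poly x.
  by rewrite /mask_poly mulrA -rmorphM /= mulfV ?mul1r // q_neq0.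
have csum (r : seq int) : \sum_(d <- r) e2pi (d%:~R * x) =
    ((\sum_(d <- r) a d) +i* (\sum_(d <- r) b d))%C.
  have addE (z1 z2 : R[i]) : z1 + z2 =
      ((complex.Re z1 + complex.Re z2) +i* (complex.Im z1 + complex.Im z2))%C.
    by case: z1 z2 => ? ? [].
  elim: r => [|d r IH]; first by rewrite !big_nil.
  by rewrite !big_cons IH addE.
have [sa sb] : \sum_(d <- D) a d = q * u /\ \sum_(d <- D) b d = q * w.
  move: sumE; rewrite csum /u /w; case: (mask_poly x) => u' w' /=; simpc.
  by case.
have var : \sum_(d <- D) ((a d - u) ^+ 2 + (b d - w) ^+ 2) = 0.
  transitivity (\sum_(d <- D) (2 - 2 * u * a d - 2 * w * b d)).
    by apply: eq_bigr => d _; have := ab d; have := uw; lra.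
  rewrite !sumrB -!mulr_sumr sa sb big_const_seq count_predT iter_addr_0.
  by transitivity (2 * q * (1 - (u ^+ 2 + w ^+ 2))); [ring|rewrite uw subrr mulr0].
have eqm d : d \in D -> a d = u /\ b d = w.
  move=> dD; move: var; rewrite (big_rem d) //= => /eqP.
  rewrite paddr_eq0 ?sumr_ge0 ?addr_ge0 ?sqr_ge0 // => [|i _]; last by rewrite addr_ge0 ?sqr_ge0.
  rewrite paddr_eq0 ?sqr_ge0 // !sqrf_eq0 !subr_eq0 => /andP[/andP[/eqP -> /eqP ->] _].
  by [].
move=> d dD; have [ad bd] := eqm _ dD; have [a0 b0] := eqm _ D0.
have : e2pi (d%:~R * x) = e2pi (0%:~R * x).
  move: ad bd a0 b0; rewrite /a /b; case: (e2pi _) => ? ?; case: (e2pi _) => ? ? /=.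
  by move=> -> -> -> ->.
by rewrite mul0r e2pi0.
Qed.

(** By Bezout, the integers n for which n x is an integer are closed under gcd. *)
Lemma fset_gcd_int (x : R) : fset_gcd D = 1 ->
  (forall d, d \in D -> exists k : int, d%:~R * x = k%:~R :> R) ->
  exists k : int, x = k%:~R.
Proof.
move=> gcd1 Dx.
suff [k xk] : exists k : int, (fset_gcd D)%:~R * x = k%:~R.
  by exists k; rewrite -xk gcd1 mul1r.
rewrite /fset_gcd big_seq; elim/big_ind: _ => //; first by exists 0; rewrite mul0r.
move=> m n [k mk] [l nl]; have [a [c <-]] := Bezoutz m n.
exists (a * k + c * l).
by rewrite intrD mulrDl !intrM -!mulrA mk nl intrD !intrM.
Qed.

(** If the fiber meets [-B, B] at x0, its other points there differ from x0 by an integer of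
    absolute value at most 2B. *)
Lemma e2pi_fiber (z : R[i]) (B : R) : exists zs : seq R,
  forall x, `|x| <= B -> e2pi x = z -> x \in zs.
Proof.
have [[x0 [x0B ex0]]|nex] := pselect (exists x0, `|x0| <= B /\ e2pi x0 = z); last first.
  by exists [::] => x xB ex; case: nex; exists x.
pose M := Num.bound (B + B).
exists ([seq x0 + k%:R | k <- iota 0 M] ++ [seq x0 - k%:R | k <- iota 0 M]) => x xB ex.
have : e2pi (x - x0) = 1.
  by rewrite e2piD e2piN ex ex0 mul_conj -ex0 nsq_e2pi.
move=> /e2pi_eq1[k xk].
have kM : (`|k| < M)%N.
  rewrite -(@ltr_nat R) natr_absz intr_norm -xk.
  apply: le_lt_trans (archi_boundP _); last by rewrite addr_ge0 // (le_trans _ xB).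
  by apply: le_trans (ler_normB _ _) _; rewrite lerD.
rewrite mem_cat; apply/orP.
have -> : x = x0 + k%:~R by rewrite -xk addrC subrK.
case: k kM {xk} => n kM; [left|right]; apply/mapP.
  by exists n => //; rewrite mem_iota.
by exists n.+1; rewrite ?mem_iota ?NegzE ?rmorphN.
Qed.

(** Multiplying by e(m x) with m at least every |d| clears the negative exponents: up to a nonzero
    constant factor, the mask becomes a polynomial in e(x). It is nonzero since its coefficient of
    degree m, coming from d = 0 alone, is 1. *)
Lemma mask_roots : exists rs : seq R[i], forall x, mask_poly x = 0 -> e2pi x \in rs.
Proof.
pose m := (\sum_(d <- D) `|d|)%N.
have dm d : d \in D -> (absz (d + m%:Z))%:Z = d + m%:Z.
  move=> dD; apply: gez0_abs; rewrite -lerBlDr sub0r.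
  have : (`|d| <= m)%N by rewrite /m (big_rem d) //= leq_addr.
  by rewrite -lez_nat abszE ler_norml => /andP[].
pose P : {poly R[i]} := \sum_(d <- D) 'X^(absz (d + m%:Z)).
have e2piX x n : e2pi x ^+ n = e2pi (n%:R * x).
  by elim: n => [|n IH]; rewrite ?expr0 ?mul0r ?e2pi0 // exprS IH -e2piD -addn1 natrD mulrDl mul1r addrC.
have PE x : P.[e2pi x] = e2pi (m%:R * x) * \sum_(d <- D) e2pi (d%:~R * x).
  rewrite horner_sum mulr_sumr big_seq [RHS]big_seq; apply: eq_bigr => d dD.
  rewrite hornerXn e2piX -e2piD -mulrDl; congr (e2pi (_ * _)).
  by rewrite -[(absz _)%:R]/((absz (d + m%:Z))%:Z%:~R) dm // intrD addrC.
have P0 : P != 0.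
  apply/eqP => /(congr1 (fun p : {poly R[i]} => p`_m)); rewrite coef0 coef_sum.
  rewrite (big_rem 0) //= coefXn. rewrite add0n eqxx big_seq big1 => [/eqP|d].
    by rewrite addr0 oner_eq0.
  rewrite mem_rem_uniq ?fset_uniq // inE => /andP[dn0 dD].
  rewrite coefXn -eqz_nat dm // -subr_eq0 opprD addrCA subrr addr0 oppr_eq0.
  by rewrite (negbTE dn0).
have [rs Prs] := closed_field_poly_normal P.
exists rs => x mx; rewrite -root_prod_XsubC -(rootZ _ _ (a := lead_coef P)) ?lead_coef_eq0 //.
rewrite -Prs /root PE; move: mx; rewrite /mask_poly => /eqP.
rewrite mulf_eq0 => /orP[|/eqP ->]; last by rewrite mulr0.
rewrite -[0]/((0 : R)%:C%C) (inj_eq (@complexI R)) invr_eq0 (negbTE cardD_neq0).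
by [].
Qed.

Lemma mask_zeros (B : R) : exists zs : seq R,
  forall x, `|x| <= B -> mask_poly x = 0 -> x \in zs.
Proof.
have [rs rsP] := mask_roots.
have [zs zsP] : exists zs : seq R, forall x, `|x| <= B -> e2pi x \in rs -> x \in zs.
  elim: rs {rsP} => [|z rs [zs IH]]; first by exists [::].
  have [zs' zsP'] := e2pi_fiber z B; exists (zs' ++ zs) => x xB.
  rewrite inE mem_cat => /orP[/eqP ez|xrs]; first by rewrite zsP'.
  by rewrite IH // orbT.
by exists zs => x xB /rsP; exact: zsP.
Qed.

End Mask.

(** As g(0) = 1, [g] has no zero near 0, so g(x / N^n) is nonzero for |x| <= B and one fixed n. A
    zero x of [g] then comes from a factor p(x / N^i) = 0 with 1 <= i <= n, and each such factor has
    finitely many zeros in range. *)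
Lemma refinable_zeros (R : realType) (N : int) (p g : R -> R) : 1 < `|N| ->
  (forall x, g x = p (x / N%:~R) * g (x / N%:~R)) ->
  g 0 = 1 -> continuous g ->
  (forall B : R, exists zs : seq R, forall x, `|x| <= B -> p x = 0 -> x \in zs) ->
  forall B : R, exists zs : seq R, forall x, `|x| <= B -> g x = 0 -> x \in zs.
Proof.
move=> N1 gE g0 gc pz B.
have NR0 : N%:~R != 0 :> R by rewrite intr_eq0 -normr_gt0 (lt_trans _ N1).
have N1R : 1 <= `|N%:~R : R| by rewrite -intr_norm -[1]/(1%:~R) ler_int ltW.
have step n : exists zs : seq R, forall x, `|x| <= B ->
    g x = 0 -> g (x / N%:~R ^+ n) != 0 -> x \in zs.
  elim: n => [|n [zs IH]].
    by exists [::] => x _ gx; rewrite expr0 divr1 gx eqxx.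
  have [zp zpP] := pz B.
  exists ([seq N%:~R ^+ n.+1 * z | z <- zp] ++ zs) => x xB gx gn.
  rewrite mem_cat; apply/orP.
  have := gE (x / N%:~R ^+ n); rewrite -mulrA -invfM -exprSr => gE'.
  have [pn|pn] := eqVneq (p (x / N%:~R ^+ n.+1)) 0; [left|right].
    apply/mapP; exists (x / N%:~R ^+ n.+1); last by rewrite mulrC divfK // expf_neq0.
    apply: zpP => //; rewrite normrM normfV normrX.
    rewrite ler_pdivrMr ?exprn_gt0 ?(lt_le_trans ltr01) //.
    apply: (le_trans xB); rewrite ler_peMr ?exprn_ege1 //.
    by rewrite (le_trans (normr_ge0 x)).
  by apply: IH => //; rewrite gE' mulf_neq0.
have [/= e e0 ge] : nbhs_ball (0 : R) (fun x => g x != 0).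
  apply/nbhs_ballP; have /cvgr_neq0 := gc 0; rewrite g0; apply; exact: oner_neq0.
have [n Bn] : exists n, B / `|N%:~R| ^+ n < e.
  have : B / `|N%:~R| ^+ n @[n --> \oo] --> (0 : R).
    rewrite -[X in _ --> X](mulr0 B); apply: cvgM; first exact: cvg_cst.
    under eq_fun do rewrite -exprVn.
    apply: cvg_expr; rewrite normfV normr_id invf_lt1 ?(lt_le_trans ltr01) //.
    by rewrite -intr_norm -[1]/(1%:~R) ltr_int.
  move=> /cvgr_lt/(_ e e0)[n _ /(_ n (leqnn _))]; by exists n.
have [zs zsP] := step n; exists zs => x xB gx; apply: zsP => //.
apply: ge; rewrite /ball /= sub0r normrN normrM normfV normrX.
apply: le_lt_trans Bn; rewrite ler_wpM2r // invr_ge0 exprn_ge0 //.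
Qed.

(** * Integrals of bounded complex functions *)

Section ComplexIntegral.
Variables (R : realType) (mu : probability (measurableTypeR R) R).
Local Notation Rm := (measurableTypeR R).
Implicit Types (f g : Rm -> R[i]).

Lemma muT : mu setT = 1%E.
Proof. exact: probability_setT. Qed.

Lemma bounded_integrable (h : Rm -> R) (M : R) :
  measurable_fun setT h -> (forall x, `|h x| <= M) ->
  mu.-integrable setT (EFin \o h).
Proof.
move=> mh hM; apply: (@le_integrable _ _ _ mu setT measurableT _ (EFin \o cst M)).
- exact/measurable_EFinP.
- by move=> x _; rewrite /= lee_fin (le_trans (hM x)) // ler_norm.
- exact: finite_measure_integrable_cst.
Qed.

Definition Cbounded f := exists M : R,
  forall x, `|complex.Re (f x)| <= M /\ `|complex.Im (f x)| <= M.

(** A class stable under the operations used below, on which the componentwise integral is defined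
    and linear. *)
Definition bddm f := Cmeasurable f /\ Cbounded f.

Lemma bddm_Re f : bddm f -> mu.-integrable setT (EFin \o (fun x => complex.Re (f x))).
Proof. by move=> [[mr mi] [M fM]]; apply: (bounded_integrable (M := M) mr) => x; have [] := fM x. Qed.

Lemma bddm_Im f : bddm f -> mu.-integrable setT (EFin \o (fun x => complex.Im (f x))).
Proof. by move=> [[mr mi] [M fM]]; apply: (bounded_integrable (M := M) mi) => x; have [] := fM x. Qed.

Lemma Re_add (z w : R[i]) : complex.Re (z + w) = complex.Re z + complex.Re w.
Proof. by case: z w => ? ? []. Qed.
Lemma Im_add (z w : R[i]) : complex.Im (z + w) = complex.Im z + complex.Im w.
Proof. by case: z w => ? ? []. Qed.
Lemma Re_mul (z w : R[i]) :
  complex.Re (z * w) = complex.Re z * complex.Re w - complex.Im z * complex.Im w.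
Proof. by case: z w => ? ? []. Qed.
Lemma Im_mul (z w : R[i]) :
  complex.Im (z * w) = complex.Re z * complex.Im w + complex.Im z * complex.Re w.
Proof. by case: z w => ? ? []. Qed.

Lemma Re_conj (z : R[i]) : complex.Re z^*%C = complex.Re z.
Proof. by case: z. Qed.
Lemma Im_conj (z : R[i]) : complex.Im z^*%C = - complex.Im z.
Proof. by case: z. Qed.

Lemma CmeasurableD f g : Cmeasurable f -> Cmeasurable g ->
  Cmeasurable (fun x => f x + g x).
Proof.
move=> [fr fi] [gr gi]; split.
  by under eq_fun do rewrite Re_add; exact: measurable_funD.
by under eq_fun do rewrite Im_add; exact: measurable_funD.
Qed.

Lemma CmeasurableM f g : Cmeasurable f -> Cmeasurable g ->
  Cmeasurable (fun x => f x * g x).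
Proof.
move=> [fr fi] [gr gi]; split.
  by under eq_fun do rewrite Re_mul; apply: measurable_funB; exact: measurable_funM.
by under eq_fun do rewrite Im_mul; apply: measurable_funD; exact: measurable_funM.
Qed.

Lemma Cmeasurable_cst z : Cmeasurable (fun=> z : R[i]).
Proof. by split; exact: measurable_cst. Qed.

Lemma Cmeasurable_conj f : Cmeasurable f -> Cmeasurable (fun x => (f x)^*%C).
Proof.
move=> [fr fi]; split; first by under eq_fun do rewrite Re_conj.
by under eq_fun do rewrite Im_conj; exact: measurableT_comp.
Qed.

Lemma Cmeasurable_e2pi l : Cmeasurable (fun x : Rm => e2pi (l * x)).
Proof.
split; apply: continuous_measurable_fun => x.
  apply: (@continuous_comp _ _ _ ( *%R l) (fun t => complex.Re (e2pi t))).
    exact: mulrl_continuous.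
  exact: continuous_e2piRe.
apply: (@continuous_comp _ _ _ ( *%R l) (fun t => complex.Im (e2pi t))).
  exact: mulrl_continuous.
exact: continuous_e2piIm.
Qed.

Lemma measurable_nsq f : Cmeasurable f -> measurable_fun setT (fun x => nsq (f x)).
Proof. by move=> [fr fi]; apply: measurable_funD; exact: measurable_funX. Qed.

Lemma CboundedP f : (exists M : R, forall x, nsq (f x) <= M) <-> Cbounded f.
Proof.
split=> -[M fM]; last first.
  exists (M ^+ 2 + M ^+ 2) => x; have [re im] := fM x.
  by rewrite /nsq lerD // -real_normK ?num_real // lerXn2r // nnegrE (le_trans _ re).
exists (Num.max 1 M) => x; have := fM x; rewrite /nsq.
move: (complex.Re _) (complex.Im _) => a b abM.
have aux (c : R) : c ^+ 2 <= M -> `|c| <= Num.max 1 M.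
  move=> cM; rewrite le_max; have [//|c1 /=] := leP `|c| 1.
  apply: le_trans cM; rewrite -real_normK ?num_real // expr2.
  by rewrite ler_peMr // ltW.
by split; apply: aux; apply: le_trans abM; rewrite ?lerDl ?lerDr sqr_ge0.
Qed.

Lemma bddmD f g : bddm f -> bddm g -> bddm (fun x => f x + g x).
Proof.
move=> [mf [M fM]] [mg [K gK]]; split; first exact: CmeasurableD.
exists (M + K) => x; have [? ?] := fM x; have [? ?] := gK x.
by rewrite Re_add Im_add; split; rewrite (le_trans (ler_normD _ _)) ?lerD.
Qed.

Lemma bddmM f g : bddm f -> bddm g -> bddm (fun x => f x * g x).
Proof.
move=> [mf /CboundedP[M fM]] [mg /CboundedP[K gK]]; split; first exact: CmeasurableM.
apply/CboundedP; exists (M * K) => x; rewrite nsqM ler_pM ?nsq_ge0 //.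
Qed.

Lemma bddm_cst z : bddm (fun=> z).
Proof.
split; first exact: Cmeasurable_cst.
by apply/CboundedP; exists (nsq z).
Qed.

Lemma bddm_conj f : bddm f -> bddm (fun x => (f x)^*%C).
Proof.
move=> [mf /CboundedP[M fM]]; split; first exact: Cmeasurable_conj.
by apply/CboundedP; exists M => x; rewrite nsq_conj.
Qed.

Lemma bddm_e2pi l : bddm (fun x : Rm => e2pi (l * x)).
Proof.
split; first exact: Cmeasurable_e2pi.
by apply/CboundedP; exists 1 => x; rewrite nsq_e2pi.
Qed.

Lemma CintegralD f g : bddm f -> bddm g ->
  Cintegral mu (fun x => f x + g x) = Cintegral mu f + Cintegral mu g.
Proof.
move=> bf bg; apply/eqP; rewrite eq_complex; apply/andP; split; apply/eqP => /=.
  under eq_Rintegral do rewrite Re_add.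
  by rewrite RintegralD //; exact: bddm_Re.
under eq_Rintegral do rewrite Im_add.
by rewrite RintegralD //; exact: bddm_Im.
Qed.

Lemma CintegralZ z f : bddm f ->
  Cintegral mu (fun x => z * f x) = z * Cintegral mu f.
Proof.
move=> bf; have fr := bddm_Re bf; have fi := bddm_Im bf.
have Zi (c : R) h : mu.-integrable setT (EFin \o h) ->
    mu.-integrable setT (EFin \o (fun x => c * h x)).
  by move=> ih; apply: (integrableZl measurableT c ih).
apply/eqP; rewrite eq_complex; apply/andP; split; apply/eqP.
  rewrite Re_mul /=; under eq_Rintegral do rewrite Re_mul.
  by rewrite RintegralB ?RintegralZl //; exact: Zi.
rewrite Im_mul /=; under eq_Rintegral do rewrite Im_mul.
by rewrite RintegralD ?RintegralZl //; exact: Zi.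
Qed.

Lemma Cintegral_cst z : Cintegral mu (fun=> z) = z.
Proof.
have intE (r : R) : \int[mu]_x r = r.
  rewrite Rintegral_cst // -[RHS]mulr1; congr (_ * _).
  by rewrite -[RHS]/(fine 1%E) -muT.
by rewrite /Cintegral !intE; case: z.
Qed.

Lemma bddm_sum (I : Type) (r : seq I) (F : I -> Rm -> R[i]) :
  (forall i, bddm (F i)) -> bddm (fun x => \sum_(i <- r) F i x).
Proof.
move=> bF; elim: r => [|i r IH].
  by under eq_fun do rewrite big_nil; exact: bddm_cst.
by under eq_fun do rewrite big_cons; exact: bddmD.
Qed.

Lemma Cintegral_sum (I : Type) (r : seq I) (F : I -> Rm -> R[i]) :
  (forall i, bddm (F i)) ->
  Cintegral mu (fun x => \sum_(i <- r) F i x) = \sum_(i <- r) Cintegral mu (F i).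
Proof.
move=> bF; elim: r => [|i r IH].
  by under eq_fun do rewrite big_nil; rewrite big_nil Cintegral_cst.
under eq_fun do rewrite big_cons; rewrite big_cons CintegralD ?IH //.
exact: bddm_sum.
Qed.

(** * The Fourier transform and the squared L^2 norm *)

Definition fourier (x : R) : R[i] := Cintegral mu (fun t : Rm => e2pi (x * t)).

Lemma L2inner_e2pi l l' :
  L2inner mu (fun t => e2pi (l * t)) (fun t => e2pi (l' * t)) = fourier (l - l').
Proof.
congr (Cintegral mu _); apply/funext => t.
by rewrite -e2piN -e2piD mulrBl.
Qed.

Lemma fourier0 : fourier 0 = 1.
Proof.
rewrite /fourier -[RHS]Cintegral_cst; congr (Cintegral mu _); apply/funext => t.
by rewrite mul0r e2pi0.
Qed.

Lemma Cintegral_conj f : bddm f ->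
  Cintegral mu (fun x => (f x)^*%C) = (Cintegral mu f)^*%C.
Proof.
move=> bf; apply/eqP; rewrite eq_complex; apply/andP; split; apply/eqP.
  by rewrite Re_conj /=; under eq_Rintegral do rewrite Re_conj.
rewrite Im_conj /=; under eq_Rintegral do rewrite Im_conj -mulN1r.
by rewrite RintegralZl ?mulN1r //; exact: bddm_Im.
Qed.

Lemma fourierN x : fourier (- x) = (fourier x)^*%C.
Proof.
rewrite /fourier -Cintegral_conj; last exact: bddm_e2pi.
by congr (Cintegral mu _); apply/funext => t; rewrite mulNr e2piN.
Qed.

Definition L2sq f : \bar R := (\int[mu]_x (nsq (f x))%:E)%E.

Lemma L2sq_ge0 f : (0 <= L2sq f)%E.
Proof. by apply: integral_ge0 => x _; rewrite lee_fin nsq_ge0. Qed.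

Lemma L2sq_bddm f : bddm f -> L2sq f = (complex.Re (Cintegral mu (fun x => f x * (f x)^*%C)))%:E.
Proof.
move=> bf; rewrite /L2sq /= /Rintegral fineK.
  by apply: eq_integral => x _; rewrite mul_conj.
by apply: integrable_fin_num => //; apply: bddm_Re; apply: bddmM => //; exact: bddm_conj.
Qed.

Lemma L2normE f : L2norm mu f = (L2sq f `^ 2^-1)%E.
Proof.
rewrite /L2norm unlock /L2sq; congr (_ `^ _)%E; apply: eq_integral => x _ /=.
rewrite normcE_nsq ger0_norm ?sqrtr_ge0 // powR_mulrn ?sqrtr_ge0 //.
by rewrite sqr_sqrtr // nsq_ge0.
Qed.

Lemma L2norm_lt f (e : R) : 0 < e -> (L2norm mu f < e%:E)%E <-> (L2sq f < (e ^+ 2)%:E)%E.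
Proof.
move=> e0; rewrite L2normE; have := L2sq_ge0 f; case: (L2sq f) => [r|_|//].
  rewrite lee_fin => r0; rewrite poweR_EFin !lte_fin.
  have -> : r `^ 2^-1 = Num.sqrt r by rewrite powR12_sqrt.
  split=> h; last by rewrite -(ltr_pXn2r (n := 2)) ?nnegrE ?sqrtr_ge0 ?(ltW e0) // sqr_sqrtr.
  by rewrite -[r]sqr_sqrtr // ltr_pXn2r ?nnegrE ?sqrtr_ge0 ?(ltW e0).
by rewrite poweRyr ?invr_neq0 ?pnatr_eq0.
Qed.

Lemma in_L2P f : in_L2 mu f <-> Cmeasurable f /\ (L2sq f < +oo)%E.
Proof.
rewrite /in_L2 L2normE; split=> -[mf]; have := L2sq_ge0 f; case: (L2sq f) => [r _|_|//].
- by rewrite !ltry.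
- by rewrite poweRyr ?invr_neq0 ?pnatr_eq0.
- by move=> _; split => //; rewrite poweR_EFin ltry.
- by [].
Qed.

Lemma in_L2_e2pi l : in_L2 mu (fun t => e2pi (l * t)).
Proof.
apply/in_L2P; split; first exact: Cmeasurable_e2pi.
rewrite /L2sq; under eq_integral do rewrite nsq_e2pi.
rewrite integral_cst // mul1e.
by apply: le_lt_trans (ltry 1); rewrite -[leRHS]muT.
Qed.

End ComplexIntegral.

(** * The Fourier transform of mu *)

Lemma measurable_phi (R : realType) (N d : int) :
  measurable_fun setT (phi N d : measurableTypeR R -> measurableTypeR R).
Proof.
apply: measurable_funM; first exact: measurable_cst.
by apply: measurable_funD => //; exact: measurable_cst.
Qed.

Section SelfSimilar.
Variables (R : realType) (N : int) (D : {fset int}).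
Variable mu : probability (measurableTypeR R) R.
Local Notation Rm := (measurableTypeR R).
Hypothesis D0 : 0 \in D.
Hypothesis muND : is_muND N D mu.

Let qV : {nonneg R} := (NngNum (ler0n R #|`D|))%:num^-1%:nng.

(** The equation for mu exhibits it as a finite sum of scaled push-forwards, and integrals of
    nonnegative functions distribute over such a sum. *)
Lemma ge0_integral_muND (F : Rm -> \bar R) :
  measurable_fun setT F -> (forall x, 0 <= F x)%E ->
  (\int[mu]_x F x = \sum_(d <- D) ((#|`D|%:R)^-1)%:E * \int[mu]_x F (phi N d x))%E.
Proof.
move=> mF F0.
pose m' (i : nat) : {measure set Rm -> \bar R} :=
  mscale qV (pushforward mu (phi N (D`_i))).
pose m_ := m' (fun i => @measurable_phi R N (D`_i)).
rewrite (eq_measure_integral (msum m_ #|`D|)); last first.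
  move=> A mA _; apply: (etrans (muND mA)); rewrite /msum (big_nth 0) big_mkord.
  by apply: eq_bigr.
rewrite ge0_integral_measure_sum // (big_nth 0) big_mkord.
apply: eq_bigr => i _; rewrite ge0_integral_mscale //.
by rewrite ge0_integral_pushforward //; exact: measurable_phi.
Qed.

(** The function h + M is nonnegative, and the weights 1/q add up to 1, so the constant M cancels
    from both sides. *)
Lemma integral_muND (h : Rm -> R) (M : R) : measurable_fun setT h ->
  (forall x, `|h x| <= M) ->
  \int[mu]_x h x = (#|`D|%:R)^-1 * \sum_(d <- D) \int[mu]_x h (phi N d x).
Proof.
move=> mh hM.
have shift (k : Rm -> R) : measurable_fun setT k -> (forall x, `|k x| <= M) ->
    (\int[mu]_x (k x + M)%:E = (\int[mu]_x k x + M)%:E)%E.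
  move=> mk kM; have ik := bounded_integrable mu mk kM.
  have iM := finite_measure_integrable_cst mu M measurableT.
  have -> : (\int[mu]_x (k x + M)%:E = \int[mu]_x (k x)%:E + \int[mu]_x M%:E)%E.
    exact: (integralD_EFin measurableT ik iM).
  have -> : (\int[mu]_x M%:E = M%:E)%E.
    by rewrite integral_cst // -[X in (_ * X)%E]/(mu setT) (muT mu) mule1.
  rewrite EFinD /Rintegral fineK //.
  exact: integrable_fin_num.
have hMD d x : `|h (phi N d x)| <= M by [].
have mhD d : measurable_fun setT (fun x => h (phi N d x)).
  by apply: measurableT_comp => //; exact: measurable_phi.
have mF : measurable_fun setT (fun x => (h x + M)%:E).
  by apply/measurable_EFinP; apply: measurable_funD => //; exact: measurable_cst.
have F0 x : (0 <= (h x + M)%:E)%E.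
  by rewrite lee_fin; have := hM x; rewrite ler_norml => /andP[]; lra.
have := ge0_integral_muND mF F0; rewrite shift //.
under eq_bigr do rewrite shift // -EFinM.
rewrite sumEFin => /(congr1 fine) /=; rewrite -mulr_sumr big_split /=.
rewrite big_const_seq count_predT iter_addr_0 mulrDr.
by rewrite -[M *+ _]mulr_natl mulKf ?(cardD_neq0 R D0) // => /addIr.
Qed.

Lemma Re_sum (I : Type) (r : seq I) (F : I -> R[i]) :
  complex.Re (\sum_(i <- r) F i) = \sum_(i <- r) complex.Re (F i).
Proof. by elim: r => [|i r IH]; rewrite ?big_nil // !big_cons Re_add IH. Qed.
Lemma Im_sum (I : Type) (r : seq I) (F : I -> R[i]) :
  complex.Im (\sum_(i <- r) F i) = \sum_(i <- r) complex.Im (F i).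
Proof. by elim: r => [|i r IH]; rewrite ?big_nil // !big_cons Im_add IH. Qed.

(** Self-similarity of mu together with e(x (t + d) / N) = e(d x / N) e(x t / N). *)
Lemma fourierE x : fourier mu x = mask_poly D (x / N%:~R) * fourier mu (x / N%:~R).
Proof.
rewrite /mask_poly -mulrA mulr_suml.
have -> : \sum_(d <- D) e2pi (d%:~R * (x / N%:~R)) * fourier mu (x / N%:~R) =
    \sum_(d <- D) Cintegral mu (fun t => e2pi (x * phi N d t)).
  apply: eq_bigr => d _; rewrite /fourier -CintegralZ; last exact: bddm_e2pi.
  congr (Cintegral mu _); apply/funext => t; rewrite -e2piD; congr e2pi.
  by rewrite /phi; ring.
have [[mr mi] [M fM]] := bddm_e2pi x.
apply/eqP; rewrite eq_complex; apply/andP; split; apply/eqP.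
  rewrite Re_mul /= mul0r subr0 Re_sum (@integral_muND _ M) // => t.
  by case: (fM t).
rewrite Im_mul /= mul0r addr0 Im_sum (@integral_muND _ M) // => t.
by case: (fM t).
Qed.

End SelfSimilar.

(** * Continuity and size of the Fourier transform *)

Section Hat.
Variables (R : realType) (mu : probability (measurableTypeR R) R).
Local Notation Rm := (measurableTypeR R).

Lemma continuous_integral_param (k : R -> R) (M : R) : continuous k ->
  (forall x, `|k x| <= M) ->
  continuous (fun x : R => \int[mu]_t k (x * t)).
Proof.
move=> kc kM x.
have mk y : measurable_fun setT (fun t : Rm => k (y * t)).
  apply: continuous_measurable_fun => t.
  by apply: (@continuous_comp _ _ _ ( *%R y) k); [exact: mulrl_continuous|exact: kc].
apply: (@continuity_under_integral R _ Rm mu (fun y t => k (y * t)) setT measurableT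
    (x - 1) (x + 1) _ _ (cst M)).
- by move=> y _; exact: (bounded_integrable mu (mk y)).
- apply: aeW => t _ y _.
  apply: (@continuous_comp R R R (fun z => z * (t : R)) k y); last exact: kc.
  exact: mulrr_continuous.
- exact: finite_measure_integrable_cst.
- by move=> y _; apply: aeW => t _ /=.
- by rewrite inE /= in_itv /= ltrBlDr ltrDl ltr01.
Qed.

Lemma continuous_nsq_fourier : continuous (fun x => nsq (fourier mu x)).
Proof.
pose c (x : R) : R := \int[mu]_t complex.Re (e2pi (x * t)).
pose s (x : R) : R := \int[mu]_t complex.Im (e2pi (x * t)).
have cc : continuous c.
  exact: (continuous_integral_param (@continuous_e2piRe R) (fun t => cos_max _)).
have cs : continuous s.
  exact: (continuous_integral_param (@continuous_e2piIm R) (fun t => sin_max _)).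
have -> : (fun x => nsq (fourier mu x)) = (fun x => c x * c x + s x * s x).
  by apply/funext => x; rewrite /nsq !expr2.
move=> x; apply: (cvgD (f := fun x => c x * c x) (g := fun x => s x * s x)).
  exact: (cvgM (cc x) (cc x)).
exact: (cvgM (cs x) (cs x)).
Qed.

(** The integral of |e(x t) - mu^(x)|^2 over t is 1 - |mu^(x)|^2, and it is nonnegative. *)
Lemma nsq_fourier_le1 x : nsq (fourier mu x) <= 1.
Proof.
have bf : bddm (fun t : Rm => e2pi (x * t) + - fourier mu x).
  by apply: bddmD; [exact: bddm_e2pi|exact: bddm_cst].
have := L2sq_ge0 mu (fun t : Rm => e2pi (x * t) + - fourier mu x).
rewrite L2sq_bddm // lee_fin.
have -> : (fun t : Rm => (e2pi (x * t) + - fourier mu x) * (e2pi (x * t) + - fourier mu x)^*%C) =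
  (fun t => (1 + (nsq (fourier mu x))%:C%C) +
    ((- (fourier mu x)^*%C) * e2pi (x * t) + (- fourier mu x) * e2pi ((- x) * t))).
  apply/funext => t; rewrite (mulNr x t) e2piN -mul_conj.
  have -> : (e2pi (x * t) - fourier mu x)^*%C = (e2pi (x * t))^*%C - (fourier mu x)^*%C.
    exact: rmorphB.
  have e1 : e2pi (x * t) * (e2pi (x * t))^*%C = 1 by rewrite mul_conj nsq_e2pi.
  move: e1; move: (e2pi _) (e2pi _)^*%C (fourier mu x) (fourier mu x)^*%C => a b h h' e1.
  by transitivity (a * b + h * h' + (- h' * a + - h * b)); [ring|rewrite e1].
rewrite CintegralD; [|exact: bddm_cst|]; last first.
  by apply: bddmD; apply: bddmM; (exact: bddm_cst || exact: bddm_e2pi).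
rewrite Cintegral_cst CintegralD; try by apply: bddmM; (exact: bddm_cst || exact: bddm_e2pi).
rewrite !CintegralZ; try exact: bddm_e2pi.
rewrite -!/(fourier mu _) fourierN; case: (fourier mu x) => a b; rewrite /nsq /=; nra.
Qed.

End Hat.

(** * Density of exponentials *)

Section TrigPoly.
Variable R : realType.

(** Entries are pairs (frequency, coefficient). Frequencies are arbitrary reals and may repeat, so
    addition is concatenation. *)
Definition tpoly (s : seq (R * R[i])) (x : R) : R[i] :=
  \sum_(p <- s) p.2 * e2pi (p.1 * x).

Definition trig (f : R -> R[i]) := exists s, f = tpoly s.

Lemma trigD f g : trig f -> trig g -> trig (fun x => f x + g x).
Proof.
move=> [s ->] [t ->]; exists (s ++ t); apply/funext => x.
by rewrite /tpoly big_cat.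
Qed.

Lemma trigM f g : trig f -> trig g -> trig (fun x => f x * g x).
Proof.
move=> [s ->] [t ->]; exists [seq (p.1 + p'.1, p.2 * p'.2) | p <- s, p' <- t].
apply/funext => x; rewrite /tpoly big_allpairs_dep mulr_suml.
apply: eq_bigr => p _; rewrite mulr_sumr; apply: eq_bigr => p' _ /=.
by rewrite mulrDl e2piD mulrACA.
Qed.

Lemma trig_cst z : trig (fun=> z).
Proof.
exists [:: (0, z)]; apply/funext => x.
by rewrite /tpoly big_seq1 mul0r e2pi0 mulr1.
Qed.

Lemma trigX f n : trig f -> trig (fun x => f x ^+ n).
Proof.
move=> tf; elim: n => [|n IH].
  by under eq_fun do rewrite expr0; exact: trig_cst.
by under eq_fun do rewrite exprS; exact: trigM.
Qed.

Lemma trig_cos a b : trig (fun x => (cos (2 * pi * (a * x + b)))%:C%C).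
Proof.
exists [:: (a, 2^-1 * e2pi b); (- a, 2^-1 * e2pi (- b))]; apply/funext => x.
rewrite -[cos _]/(complex.Re (e2pi (a * x + b))) ReJ_add -e2piN.
rewrite /tpoly big_cons big_seq1 /= -!mulrA -!e2piD mulNr -opprD [b + _]addrC.
by rewrite -mulrDr mulrC.
Qed.

End TrigPoly.

(** * Polynomials in y converging to the indicator of y < 1/2 on [0, 1] *)

Section Bump.
Variable R : realType.
Implicit Types (t y : R).

Lemma bernoulli_le t n : 0 <= t <= 1 -> 1 - n%:R * t <= (1 - t) ^+ n.
Proof.
move=> /andP[t0 t1]; elim: n => [|n IH]; first by rewrite mul0r subr0.
rewrite exprSr -addn1 natrD.
have : (1 - n%:R * t) * (1 - t) <= (1 - t) ^+ n * (1 - t) by rewrite ler_wpM2r // subr_ge0.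
apply: le_trans; have : 0 <= n%:R * t * t by rewrite !mulr_ge0.
lra.
Qed.

(** Induction through (1 - t)(1 + (n+1) t) = 1 + n t - (n+1) t^2 <= 1 + n t. *)
Lemma bernoulli_inv t n : 0 <= t <= 1 -> (1 - t) ^+ n * (1 + n%:R * t) <= 1.
Proof.
move=> /andP[t0 t1]; elim: n => [|n IH]; first by rewrite mul0r addr0 mulr1.
apply: le_trans IH; rewrite exprSr -mulrA ler_wpM2l ?exprn_ge0 ?subr_ge0 //.
rewrite -addn1 natrD; have : 0 <= n%:R * t * t by rewrite !mulr_ge0.
have := sqr_ge0 t; nra.
Qed.

(** With s = sqrt r, [bernoulli_inv] at 1 - s gives n s^n <= 1 / (1 - s), so n r^n <= s^n / (1 -
    s). *)
Lemma natr_mul_expr_cvg0 r : 0 <= r < 1 -> n%:R * r ^+ n @[n --> \oo] --> (0 : R).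
Proof.
move=> /andP[r0 r1]; pose s := Num.sqrt r.
have s0 : 0 <= s by exact: sqrtr_ge0.
have s1 : s < 1 by rewrite -sqrtr1 ltr_sqrt.
have rE : r = s * s by rewrite -expr2 sqr_sqrtr.
have lim : s ^+ n / (1 - s) @[n --> \oo] --> (0 : R).
  rewrite -(mul0r (1 - s)^-1); apply: cvgM; last exact: cvg_cst.
  by apply: cvg_expr; rewrite ger0_norm.
apply: (squeeze_cvgr _ (cvg_cst 0) lim); apply: nearW => n; apply/andP; split.
  by rewrite mulr_ge0 // exprn_ge0.
rewrite rE exprMn mulrA [leRHS]mulrC ler_wpM2r ?exprn_ge0 //.
rewrite -[leRHS]mul1r ler_pdivlMr ?subr_gt0 //.
have := @bernoulli_inv (1 - s) n; have -> : 1 - (1 - s) = s by ring.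
have -> : 0 <= 1 - s <= 1 by apply/andP; split; lra.
move=> /(_ isT); have : 0 <= s ^+ n by rewrite exprn_ge0.
nra.
Qed.

(** Bernoulli's inequality bounds the expression below by 1 - m (2y)^m, where 2y < 1. *)
Lemma bump_cvg1 y : 0 <= y < 2^-1 ->
  (1 - y ^+ m) ^+ (m * 2 ^ m) @[m --> \oo] --> (1 : R).
Proof.
move=> /andP[y0 y1]; have lim : 1 - m%:R * (2 * y) ^+ m @[m --> \oo] --> (1 : R).
  rewrite -[X in _ --> X]subr0; apply: cvgB; first exact: cvg_cst.
  by apply: natr_mul_expr_cvg0; apply/andP; split; lra.
apply: (squeeze_cvgr _ lim); last exact: (cvg_cst (1 : R)).
apply: nearW => m.
have ym0 : 0 <= y ^+ m by rewrite exprn_ge0.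
have ym1 : y ^+ m <= 1 by rewrite exprn_ile1 //; lra.
apply/andP; split; last by rewrite exprn_ile1; lra.
have := @bernoulli_le (y ^+ m) (m * 2 ^ m); rewrite ym0 ym1 => /(_ isT).
by apply: le_trans; rewrite natrM natrX exprMn mulrA.
Qed.

(** Here (2y)^m >= 1, and [bernoulli_inv] gives the bound 1 / (1 + m (2y)^m) <= 1 / (m + 1). The
    factor m in the exponent handles the borderline y = 1/2. *)
Lemma bump_cvg0 y : 2^-1 <= y <= 1 ->
  (1 - y ^+ m) ^+ (m * 2 ^ m) @[m --> \oo] --> (0 : R).
Proof.
move=> /andP[y0 y1].
apply: (squeeze_cvgr (f := fun=> 0) (h := fun m => m.+1%:R^-1)); last 2 first.
- exact: cvg_cst.
- exact: cvg_harmonic.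
apply: nearW => m.
have ym0 : 0 <= y ^+ m by rewrite exprn_ge0 //; lra.
have ym1 : y ^+ m <= 1 by rewrite exprn_ile1 //; lra.
rewrite exprn_ge0 ?subr_ge0 //=.
have := @bernoulli_inv (y ^+ m) (m * 2 ^ m); rewrite ym0 ym1 => /(_ isT) b.
have h : 1 <= (2 * y) ^+ m by rewrite exprn_ege1 //; lra.
rewrite -[leRHS]mul1r ler_pdivlMr //; apply: le_trans b.
rewrite natrM natrX -mulrA -exprMn.
rewrite ler_wpM2l ?exprn_ge0 ?subr_ge0 // -addn1 natrD addrC lerD2l.
by rewrite ler_peMr.
Qed.

End Bump.

(** * The closed span in L^2(mu) of the exponentials with frequencies in L *)

Section Density.
Variables (R : realType) (mu : probability (measurableTypeR R) R) (L : set R).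
Local Notation Rm := (measurableTypeR R).
Implicit Types (f g : Rm -> R[i]).

Lemma nsqD_le (z w : R[i]) : nsq (z + w) <= 2 * nsq z + 2 * nsq w.
Proof.
case: z w => a b [c d]; rewrite /nsq /=.
have := sqr_ge0 (a - c); have := sqr_ge0 (b - d); nra.
Qed.

Lemma Cmeasurable_tpoly s : Cmeasurable (tpoly s : Rm -> R[i]).
Proof.
elim: s => [|p s IH].
  rewrite (_ : tpoly [::] = fun=> 0); first exact: Cmeasurable_cst.
  by apply/funext => x; rewrite /tpoly big_nil.
rewrite (_ : tpoly (p :: s) = fun x => p.2 * e2pi (p.1 * x) + tpoly s x).
  by apply: CmeasurableD => //; apply: CmeasurableM; [exact: Cmeasurable_cst|exact: Cmeasurable_e2pi].
by apply/funext => x; rewrite /tpoly big_cons.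
Qed.

Lemma CmeasurableN f : Cmeasurable f -> Cmeasurable (fun x => - f x).
Proof.
move=> mf; under eq_fun do rewrite -mulN1r.
by apply: CmeasurableM => //; exact: Cmeasurable_cst.
Qed.

Lemma CmeasurableB f g : Cmeasurable f -> Cmeasurable g -> Cmeasurable (fun x => f x - g x).
Proof. by move=> mf mg; apply: CmeasurableD => //; exact: CmeasurableN. Qed.

(** Stands in for the triangle inequality when working with squared norms. *)
Lemma L2sqD f g : Cmeasurable f -> Cmeasurable g ->
  (L2sq mu (fun x => f x + g x)%R <= 2%:E * L2sq mu f + 2%:E * L2sq mu g)%E.
Proof.
move=> mf mg; rewrite /L2sq.
have nf : measurable_fun setT (fun x => (nsq (f x))%:E) by (apply/measurable_EFinP; exact: measurable_nsq).
have ng : measurable_fun setT (fun x => (nsq (g x))%:E) by (apply/measurable_EFinP; exact: measurable_nsq).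
have nf2 : measurable_fun setT (fun x => 2%:E * (nsq (f x))%:E)%E by exact: measurable_funeM.
have ng2 : measurable_fun setT (fun x => 2%:E * (nsq (g x))%:E)%E by exact: measurable_funeM.
rewrite -!ge0_integralZl_EFin //; try by move=> x _; rewrite lee_fin nsq_ge0.
rewrite -ge0_integralD //; try by (move=> x _; rewrite mule_ge0 ?lee_fin ?nsq_ge0); try by [].
apply: ge0_le_integral => //.
- by move=> x _; rewrite lee_fin nsq_ge0.
- apply/measurable_EFinP; apply: measurable_nsq; exact: CmeasurableD.
- exact: emeasurable_funD.
- by move=> x _; rewrite lee_fin nsqD_le.
Qed.

Lemma L2sqZ z f : Cmeasurable f -> L2sq mu (fun x => z * f x) = ((nsq z)%:E * L2sq mu f)%E.
Proof.
move=> mf; rewrite /L2sq -ge0_integralZl_EFin ?nsq_ge0 //.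
- by apply: eq_integral => x _; rewrite nsqM.
- by move=> x _; rewrite lee_fin nsq_ge0.
- (apply/measurable_EFinP; exact: measurable_nsq).
Qed.

(** Membership in the L^2 closure of the span; as e is arbitrary, bounding the squared norm is as
    good as bounding the norm. *)
Definition span_approx f := forall e : R, 0 < e -> exists s : seq (R * R[i]),
  (forall p, p \in s -> L p.1) /\ (L2sq mu (fun x => f x - tpoly s x)%R < e%:E)%E.

(** A closure is closed. The share e / 4 compensates the factors 2 of [L2sqD]. *)
Lemma span_approx_lim f : Cmeasurable f ->
  (forall e : R, 0 < e -> exists g, [/\ Cmeasurable g, span_approx g &
     (L2sq mu (fun x => f x - g x)%R < e%:E)%E]) -> span_approx f.
Proof.
move=> mf H e e0; have e4 : 0 < e / 4 by lra.
have [g [mg ag fg]] := H _ e4; have [s [sL gs]] := ag _ e4.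
exists s; split => //.
have -> : (fun x => f x - tpoly s x) = (fun x => (f x - g x) + (g x - tpoly s x)).
  by apply/funext => x; rewrite addrA subrK.
apply: le_lt_trans (L2sqD _ _) _; try by apply: CmeasurableB => //; exact: Cmeasurable_tpoly.
have -> : (e%:E = 2%:E * (e / 4)%:E + 2%:E * (e / 4)%:E)%E.
  by rewrite -!EFinM -EFinD; congr EFin; lra.
by apply: lteD; rewrite lte_pmul2l.
Qed.

Lemma span_approxD f g : Cmeasurable f -> Cmeasurable g -> span_approx f -> span_approx g ->
  span_approx (fun x => f x + g x).
Proof.
move=> mf mg af ag e e0; have e4 : 0 < e / 4 by lra.
have [s [sL fs]] := af _ e4; have [t [tL gt]] := ag _ e4.
exists (s ++ t); split; first by move=> p; rewrite mem_cat => /orP[/sL|/tL].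
have -> : (fun x => f x + g x - tpoly (s ++ t) x) =
    (fun x => (f x - tpoly s x) + (g x - tpoly t x)).
  by apply/funext => x; rewrite /tpoly big_cat opprD addrACA.
apply: le_lt_trans (L2sqD _ _) _; try by apply: CmeasurableB => //; exact: Cmeasurable_tpoly.
have -> : (e%:E = 2%:E * (e / 4)%:E + 2%:E * (e / 4)%:E)%E.
  by rewrite -!EFinM -EFinD; congr EFin; lra.
by apply: lteD; rewrite lte_pmul2l.
Qed.

Lemma span_approxZ z f : Cmeasurable f -> span_approx f -> span_approx (fun x => z * f x).
Proof.
move=> mf af e e0; have z1 : 0 < nsq z + 1 by rewrite ltr_pwDr ?nsq_ge0.
have [s [sL fs]] := af _ (divr_gt0 e0 z1).
exists [seq (p.1, z * p.2) | p <- s]; split; first by move=> _ /mapP[p /sL pL ->].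
have -> : (fun x => z * f x - tpoly [seq (p.1, z * p.2) | p <- s] x) =
    (fun x => z * (f x - tpoly s x)).
  apply/funext => x; rewrite mulrBr /tpoly big_map mulr_sumr; congr (_ - _).
  by apply: eq_bigr => p _; rewrite mulrA.
have mfs : Cmeasurable (fun x => f x - tpoly s x) by apply: CmeasurableB => //; exact: Cmeasurable_tpoly.
rewrite L2sqZ //; apply: (@le_lt_trans _ _ ((nsq z + 1)%:E * L2sq mu (fun x => f x - tpoly s x)%R)%E).
  by apply: lee_wpmul2r; rewrite ?L2sq_ge0 // lee_fin lerDl.
by rewrite -lte_pdivlMl // -EFinM mulrC.
Qed.

(** Dominated convergence, applied to |f - f_n|^2, turns pointwise into L^2 convergence. *)
Lemma span_approx_dom (f_ : nat -> Rm -> R[i]) f (h : Rm -> R) :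
  (forall n, Cmeasurable (f_ n)) -> Cmeasurable f ->
  (forall n, span_approx (f_ n)) ->
  mu.-integrable setT (EFin \o h) ->
  (forall n x, nsq (f x - f_ n x) <= h x) ->
  (forall x, nsq (f x - f_ n x) @[n --> \oo] --> (0 : R)) ->
  span_approx f.
Proof.
move=> mf_ mf af_ ih fh flim; apply: span_approx_lim => // e e0.
have mg n : measurable_fun setT (fun x => (nsq (f x - f_ n x))%:E).
  by apply/measurable_EFinP; apply: measurable_nsq; exact: CmeasurableB.
have lim0 : {ae mu, forall x, setT x ->
    (fun n => (nsq (f x - f_ n x))%:E) @ \oo --> cst 0%E x}.
  apply: aeW => x _; apply: cvg_EFin; first exact: nearW.
  exact: flim.
have bnd : {ae mu, forall x n, setT x ->
    (`|(nsq (f x - f_ n x))%:E| <= (EFin \o h) x)%E}.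
  by apply: aeW => x n _; rewrite /= lee_fin ger0_norm ?nsq_ge0.
have [_ _] := dominated_convergence measurableT mg (measurable_cst _) lim0 ih bnd.
rewrite integral0 => /(_ [set y | (y < e%:E)%E])[].
  by apply: (open_ereal_lt' (x := 0%E)); rewrite lte_fin.
by move=> n _ /(_ n (leqnn _)) /= fn; exists (f_ n).
Qed.

Definition realC (h : Rm -> R) : Rm -> R[i] := fun x => (h x)%:C%C.

Lemma Cmeasurable_realC h : measurable_fun setT h -> Cmeasurable (realC h).
Proof. by move=> mh; split => //=; exact: measurable_cst. Qed.

Lemma nsq_realB (a b : R) : nsq (a%:C%C - b%:C%C) = (a - b) ^+ 2.
Proof. by rewrite /nsq /= oppr0 addr0 expr0n addr0. Qed.

Lemma span_approx_realC_dom (h_ : nat -> Rm -> R) (h k : Rm -> R) :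
  (forall n, measurable_fun setT (h_ n)) -> measurable_fun setT h ->
  (forall n, span_approx (realC (h_ n))) ->
  mu.-integrable setT (EFin \o k) ->
  (forall n x, (h x - h_ n x) ^+ 2 <= k x) ->
  (forall x, h_ n x @[n --> \oo] --> h x) ->
  span_approx (realC h).
Proof.
move=> mh_ mh ah ik hk hlim; apply: (@span_approx_dom (fun n => realC (h_ n)) _ k) => //.
- by move=> n; exact: Cmeasurable_realC.
- by move=> n x; rewrite nsq_realB.
- move=> x; under eq_fun do rewrite nsq_realB expr2.
  have sub : h x - h_ n x @[n --> \oo] --> (0 : R).
    by rewrite -(subrr (h x)); apply: cvgB; [exact: cvg_cst|exact: hlim].
  by rewrite -(mulr0 (0 : R)); exact: (cvgM sub sub).
Qed.

Lemma span_approx_realC_lim01 (h_ : nat -> Rm -> R) (h : Rm -> R) :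
  (forall n, measurable_fun setT (h_ n)) -> measurable_fun setT h ->
  (forall n, span_approx (realC (h_ n))) ->
  (forall n x, 0 <= h_ n x <= 1) -> (forall x, 0 <= h x <= 1) ->
  (forall x, h_ n x @[n --> \oo] --> h x) ->
  span_approx (realC h).
Proof.
move=> mh_ mh ah h01 hh01 hlim; apply: (@span_approx_realC_dom h_ _ (cst 1)) => //.
  exact: finite_measure_integrable_cst.
by move=> n x /=; have := h01 n x; have := hh01 x; nra.
Qed.

Lemma span_approx0 : span_approx (fun=> 0).
Proof.
move=> e e0; exists [::]; split => //; rewrite /L2sq.
under eq_integral do rewrite /tpoly big_nil subrr nsq0.
by rewrite integral0 lte_fin.
Qed.

(** * From all exponentials to all of L^2(mu) *)

Hypothesis span_approx_e2pi : forall x, span_approx (fun t => e2pi (x * t)).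

Lemma span_approx_trig f : trig f -> span_approx f.
Proof.
move=> [s ->]; elim: s => [|p s IH].
  rewrite (_ : tpoly [::] = fun=> 0); first exact: span_approx0.
  by apply/funext => x; rewrite /tpoly big_nil.
rewrite (_ : tpoly (p :: s) = fun x => p.2 * e2pi (p.1 * x) + tpoly s x).
  apply: span_approxD => //; [|exact: Cmeasurable_tpoly|].
    by apply: CmeasurableM; [exact: Cmeasurable_cst|exact: Cmeasurable_e2pi].
  by apply: span_approxZ => //; exact: Cmeasurable_e2pi.
by apply/funext => x; rewrite /tpoly big_cons.
Qed.

(* With y = (1 + sin)/2, the indicator of y < 1/2 is the pointwise limit of the
   trigonometric polynomials (1 - y^m)^(m 2^m). *)
Lemma span_approx_sin_lt0 a c : span_approx (realC (\1_[set x | sin (2 * pi * (a * (x - c))) < 0])).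
Proof.
pose y (x : R) := 2^-1 + 2^-1 * sin (2 * pi * (a * (x - c))).
have y01 x : 0 <= y x <= 1.
  by rewrite /y; have := sin_le1 (2 * pi * (a * (x - c)));
     have := sin_geN1 (2 * pi * (a * (x - c))); lra.
pose P (m : nat) (x : R) := (1 - y x ^+ m) ^+ (m * 2 ^ m).
(* The sine is a cosine delayed by a quarter period, which is the form [trig_cos] accepts. *)
have yE x : y x = 2^-1 + 2^-1 * cos (2 * pi * (a * x + (- (a * c) - 4^-1))).
  rewrite /y; congr (_ + _ * _); rewrite -cosBpihalf; congr cos.
  by field.
have my : measurable_fun setT y.
  apply: continuous_measurable_fun => x.
  apply: cvgD; first exact: cvg_cst.
  apply: cvgM; first exact: cvg_cst.
  apply: (@continuous_comp R R R (fun x => 2 * pi * (a * (x - c))) sin); last exact: continuous_sin.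
  apply: cvgM; first exact: cvg_cst.
  apply: cvgM; first exact: cvg_cst.
  by apply: cvgB; [exact: cvg_id|exact: cvg_cst].
have mP m : measurable_fun setT (P m).
  apply: measurable_funX; apply: measurable_funB; first exact: measurable_cst.
  exact: measurable_funX.
have tP m : trig (realC (P m)).
  have -> : realC (P m) = fun x => (1 + (-1) * (2^-1 + 2^-1 *
      (cos (2 * pi * (a * x + (- (a * c) - 4^-1))))%:C%C) ^+ m) ^+ (m * 2 ^ m).
    apply/funext => x; rewrite /realC /P yE rmorphXn rmorphB rmorphXn rmorphD rmorphM /=.
    by rewrite mulN1r fmorphV rmorph_nat.
  apply: trigX; apply: trigD; first exact: trig_cst.
  apply: trigM; first exact: trig_cst.
  apply: trigX; apply: trigD; first exact: trig_cst.
  by apply: trigM; [exact: trig_cst|exact: trig_cos].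
apply: (@span_approx_realC_lim01 P) => //.
- apply: measurable_indic; have mlt := my measurableT `]-oo, 2^-1[%classic (measurable_itv _).
  rewrite setTI in mlt; rewrite (_ : [set x | _] = y @^-1` `]-oo, 2^-1[%classic) //.
  apply/seteqP; split => x /=; rewrite in_itv /= /y; lra.
- by move=> m; apply: span_approx_trig.
- move=> m x; have /andP[y0 y1] := y01 x.
  have ym0 : 0 <= y x ^+ m by rewrite exprn_ge0.
  have ym1 : y x ^+ m <= 1 by rewrite exprn_ile1.
  by rewrite exprn_ge0 ?exprn_ile1 //; lra.
- by move=> x; rewrite indicE; case: (_ \in _) => /=; rewrite ?lexx ?ler01.
move=> x; rewrite indicE; have /andP[y0 y1] := y01 x.
have [yh|yh] := ltP (y x) 2^-1.
  rewrite mem_set /=; last by move: yh; rewrite /y; lra.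
  by apply: bump_cvg1; rewrite y0 yh.
rewrite memNset /=; last by move: yh; rewrite /y; lra.
by apply: bump_cvg0; rewrite y1 yh.
Qed.

Lemma measurable_sin_lt0 (a c : R) :
  measurable [set x : Rm | sin (2 * pi * (a * (x - c))) < 0].
Proof.
pose y (x : R) := sin (2 * pi * (a * (x - c))).
have my : measurable_fun setT (y : Rm -> Rm).
  apply: continuous_measurable_fun => x.
  apply: (@continuous_comp R R R (fun x => 2 * pi * (a * (x - c))) sin); last exact: continuous_sin.
  apply: cvgM; first exact: cvg_cst.
  apply: cvgM; first exact: cvg_cst.
  by apply: cvgB; [exact: cvg_id|exact: cvg_cst].
have mlt := my measurableT `]-oo, 0[%classic (measurable_itv _).
rewrite setTI in mlt; rewrite (_ : [set x | _] = y @^-1` `]-oo, 0[%classic) //.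
Qed.

(** Once n + 1 exceeds |x - c|, sin(pi (x - c) / (n + 1)) is negative exactly when x < c. So the
    indicators of the sets [A n] converge pointwise to that of the ray. *)
Lemma span_approx_ray c : span_approx (realC (\1_`]-oo, c[)).
Proof.
pose a (n : nat) : R := (2 * n.+1%:R)^-1.
pose A n := [set x : Rm | sin (2 * pi * (a n * (x - c))) < 0].
apply: (@span_approx_realC_lim01 (fun n => \1_(A n))).
- by move=> n; apply: measurable_indic; exact: measurable_sin_lt0.
- exact: measurable_indic.
- by move=> n; exact: span_approx_sin_lt0.
- by move=> n x; rewrite indicE; case: (_ \in _) => /=; rewrite ?lexx ?ler01.
- by move=> x; rewrite indicE; case: (_ \in _) => /=; rewrite ?lexx ?ler01.
move=> x; apply: cvg_near_cst.
have /cvgryPgt/(_ `|x - c|) : (n.+1%:R : R) @[n --> \oo] --> +oo.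
  by rewrite (cvg_shiftS (fun n => n%:R : R)); exact: cvgr_idn.
apply: filterS => n xn; rewrite !indicE; congr (_%:R); congr nat_of_bool.
rewrite ltr_norml in xn; have /andP[xn1 xn2] := xn.
have n0 : 0 < n.+1%:R :> R by [].
have thE : 2 * pi * (a n * (x - c)) = pi * ((x - c) / n.+1%:R).
  by rewrite /a invfM; move: (n.+1%:R)^-1 => k; field.
have pi0 := pi_gt0 R.
have r1 : (x - c) / n.+1%:R < 1 by rewrite ltr_pdivrMr // mul1r.
have r2 : -1 < (x - c) / n.+1%:R by rewrite ltr_pdivlMr // mulN1r.
have [xc|xc] := ltP x c.
  have r3 : (x - c) / n.+1%:R < 0 by rewrite ltr_pdivrMr // mul0r subr_lt0.
  have -> : x \in A n.
    rewrite mem_set // /A /= thE -[X in X < 0]opprK -sinN oppr_lt0.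
    move: (_ / _) r1 r2 r3 => r r1 r2 r3.
    by apply: sin_gt0_pi; apply/andP; split; nra.
  by apply/esym/mem_set; rewrite /= in_itv.
have r3 : 0 <= (x - c) / n.+1%:R by rewrite ler_pdivlMr // mul0r subr_ge0.
have /negbTE -> : x \notin A n.
  apply/negP; rewrite inE /A /= thE => /lt_geF.
  move: (_ / _) r1 r2 r3 => r r1 r2 r3.
  by rewrite sin_ge0_pi //; apply/andP; split; nra.
by apply/esym/memNset; rewrite /= in_itv /=; apply/negP; rewrite -leNgt.
Qed.

(** Dynkin's pi-lambda theorem: open left rays are stable under intersection and generate the Borel
    sets, and the sets with indicator in the closed span are stable under complements and countable
    disjoint unions. *)
Lemma span_approx_indic A : measurable A -> span_approx (realC (\1_A)).
Proof.
move=> mA.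
pose G := @RGenInftyO.G R.
have rayE : @measurable _ Rm = <<s G >>.
  by have := RGenInftyO.measurableE R.
have indB (B : set Rm) x : 0 <= (\1_B x : R) <= 1.
  by rewrite indicE; case: (_ \in _) => /=; rewrite ?lexx ?ler01.
suff : forall B, <<s G >> B -> span_approx (realC (\1_B)).
  by apply; rewrite -rayE.
apply: (@dynkin_induction _ Rm _ (fun B => span_approx (realC (\1_B)))) => //.
- move=> _ _ [a ->] [b ->]; exists (Num.min a b).
  by apply/seteqP; split => x /=; rewrite !in_itv /= lt_min; [move=> [-> ->]|move=> /andP].
- apply: span_approx_trig; rewrite (_ : realC _ = fun=> 1); first exact: trig_cst.
  by apply/funext => x; rewrite /realC indicT.
- by move=> _ [a ->]; exact: span_approx_ray.
- move=> B mB aB; rewrite (_ : realC _ = fun x => 1 + (-1) * realC (\1_B) x).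
    have mrB : Cmeasurable (realC (\1_B)) by apply: Cmeasurable_realC; exact: measurable_indic.
    apply: span_approxD; [exact: Cmeasurable_cst| |exact: span_approx_trig (trig_cst 1)|exact: span_approxZ].
    by apply: CmeasurableM => //; exact: Cmeasurable_cst.
  apply/funext => x; rewrite /realC !indicE in_setC mulN1r.
  by case: (x \in B); rewrite /= ?subrr ?subr0.
- move=> F mF tF aF.
  pose h n : Rm -> R := \1_(\big[setU/set0]_(i < n) F i).
  have hS n x : h n.+1 x = h n x + \1_(F n) x.
    rewrite /h !indicE big_ord_recr /= in_setU.
    case: (boolP (x \in F n)); rewrite ?orbT ?orbF ?addr0 // inE => Fn.
    rewrite memNset ?add0r // -bigcup_mkord => -[k /= kn Fk].
    by have := tF n k I I (ex_intro _ x (conj Fn Fk)) => nk; rewrite nk ltnn in kn.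
  apply: (@span_approx_realC_lim01 h).
  + by move=> n; apply: measurable_indic; exact: bigsetU_measurable.
  + by apply: measurable_indic; exact: bigcup_measurable.
  + elim=> [|n IH].
      rewrite (_ : realC _ = fun=> 0); first exact: span_approx0.
      by apply/funext => x; rewrite /realC /h big_ord0 indic0.
    rewrite (_ : realC _ = fun x => realC (h n) x + realC (\1_(F n)) x).
      apply: span_approxD => //; apply: Cmeasurable_realC; apply: measurable_indic => //.
      exact: bigsetU_measurable.
    by apply/funext => x; rewrite /realC hS rmorphD.
  + by move=> n x; exact: indB.
  + by move=> x; exact: indB.
  move=> x; apply: cvg_near_cst.
  have [[k _ Fk]|nF] := pselect ((\bigcup_k F k) x).
    exists k.+1 => // n /= kn; rewrite /h !indicE; congr (_%:R); congr nat_of_bool.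
    by rewrite !mem_set //; [exists k|rewrite -bigcup_mkord; exists k].
  apply: nearW => n; rewrite /h !indicE !memNset //.
  by rewrite -bigcup_mkord => -[k _ Fk]; apply: nF; exists k.
Qed.

Import HBNNSimple.

Lemma span_approx_nnsfun (h : {nnsfun Rm >-> R}) : span_approx (realC h).
Proof.
pose r := fset_set (range h).
have hE x : h x = \sum_(y <- r) y * \1_(h @^-1` [set y]) x.
  by rewrite fimfunE fsbig_finite.
have mi y : measurable (h @^-1` [set y]).
  by rewrite -[X in measurable X]setTI; exact: measurable_funP.
have ind y : Cmeasurable (realC (\1_(h @^-1` [set y]))).
  by apply: Cmeasurable_realC; exact: measurable_indic.
rewrite (_ : realC h = fun x => \sum_(y <- r) y%:C%C * realC (\1_(h @^-1` [set y])) x); last first.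
  by apply/funext => x; rewrite /realC hE rmorph_sum; apply: eq_bigr => y _; rewrite rmorphM.
suff H (s : seq R) : Cmeasurable (fun x => \sum_(y <- s) y%:C%C * realC (\1_(h @^-1` [set y])) x) /\
    span_approx (fun x => \sum_(y <- s) y%:C%C * realC (\1_(h @^-1` [set y])) x) by have [] := H r.
elim: s => [|y s [ms IH]].
  by under eq_fun do rewrite big_nil; split; [exact: Cmeasurable_cst|exact: span_approx0].
have my : Cmeasurable (fun x => y%:C%C * realC (\1_(h @^-1` [set y])) x).
  by apply: CmeasurableM => //; exact: Cmeasurable_cst.
under eq_fun do rewrite big_cons; split; first exact: CmeasurableD.
by apply: span_approxD => //; apply: span_approxZ => //; exact: span_approx_indic.
Qed.

(** Increasing simple functions h_n tend to h, and 0 <= h_n <= h gives (h - h_n)^2 <= h^2, an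
    integrable bound. *)
Lemma span_approx_ge0 (h : Rm -> R) : measurable_fun setT h -> (forall x, 0 <= h x) ->
  mu.-integrable setT (EFin \o (fun x => h x ^+ 2)) -> span_approx (realC h).
Proof.
move=> mh h0 ih.
have mEh : measurable_fun setT (EFin \o h) by exact/measurable_EFinP.
pose h_ := nnsfun_approx measurableT mEh.
have lim x : h_ n x @[n --> \oo] --> h x.
  have := @cvg_nnsfun_approx _ _ _ _ measurableT _ mEh (fun x _ => h0 x) x I.
  by move=> /fine_cvgP[].
have le_h n x : 0 <= h_ n x <= h x.
  rewrite fun_ge0 /=.
  rewrite -(cvg_lim _ (lim x)) //.
  apply: (@nondecreasing_cvgn_le R (fun n => h_ n x)); last by apply/cvg_ex; exists (h x).
  by move=> m k mk; have /lefP := nd_nnsfun_approx measurableT mEh mk.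
apply: (@span_approx_realC_dom (fun n => h_ n) _ _ _ mh _ ih) => //.
- by move=> n; exact: span_approx_nnsfun.
- by move=> n x; have := le_h n x; nra.
Qed.

(** The positive and negative parts of Re f and Im f have squares at most |f|^2, so
    [span_approx_ge0] covers each of them. *)
Lemma span_approx_L2 f : in_L2 mu f -> span_approx f.
Proof.
move=> /in_L2P[[mr mi] f2].
have imp (h k : Rm -> R) : measurable_fun setT h -> (forall x, 0 <= h x) ->
    (forall x, h x ^+ 2 <= nsq (f x)) -> span_approx (realC h).
  move=> mh h0 hf; apply: span_approx_ge0 => //; apply/integrableP; split.
    by apply/measurable_EFinP; exact: measurable_funX.
  apply: le_lt_trans f2; apply: ge0_le_integral => //.
  - by apply/measurable_EFinP; apply: measurableT_comp => //; exact: measurable_funX.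
  - by apply/measurable_EFinP; exact: measurable_nsq.
  - by move=> x _; rewrite /= lee_fin ger0_norm ?sqr_ge0.
have sqmax (a b : R) : 0 <= b -> a ^+ 2 <= b -> Num.max a 0 ^+ 2 <= b.
  by move=> b0 ab; rewrite maxEle; case: ifP; rewrite ?expr0n.
have areal (h : Rm -> R) : measurable_fun setT h -> (forall x, h x ^+ 2 <= nsq (f x)) ->
    span_approx (realC h).
  move=> mh hf.
  pose hp x := Num.max (h x) 0; pose hn x := Num.max (- h x) 0.
  have mhp : measurable_fun setT hp by apply: measurable_maxr => //; exact: measurable_cst.
  have mhn : measurable_fun setT hn.
    by apply: measurable_maxr; [exact: measurableT_comp|exact: measurable_cst].
  have -> : realC h = fun x => realC hp x + (-1) * realC hn x.
    apply/funext => x; rewrite /realC mulN1r -rmorphB /hp /hn; congr (_%:C)%C.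
    by rewrite !maxEle; case: ifP; case: ifP => /=; lra.
  have ahp : span_approx (realC hp).
    apply: imp => // x; rewrite /hp ?le_max ?lexx ?orbT //.
    by apply: sqmax => //; exact: nsq_ge0.
  have ahn : span_approx (realC hn).
    apply: imp => // x; rewrite /hn ?le_max ?lexx ?orbT //.
    by apply: sqmax; rewrite ?sqrrN //; exact: nsq_ge0.
  apply: span_approxD; [exact: Cmeasurable_realC| |exact: ahp|].
    by apply: CmeasurableM; [exact: Cmeasurable_cst|exact: Cmeasurable_realC].
  by apply: span_approxZ => //; exact: Cmeasurable_realC.
have -> : f = fun x => realC (fun x => complex.Re (f x)) x +
    'i%C * realC (fun x => complex.Im (f x)) x.
  by apply/funext => x; rewrite /realC -complexE.
apply: span_approxD.
- exact: Cmeasurable_realC.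
- by apply: CmeasurableM; [exact: Cmeasurable_cst|exact: Cmeasurable_realC].
- by apply: areal => // x; rewrite lerDl sqr_ge0.
- apply: span_approxZ; first exact: Cmeasurable_realC.
  by apply: areal => // x; rewrite lerDr sqr_ge0.
Qed.

End Density.

(** * Spectral pairs *)

Section Projection.
Variables (R : realType) (mu : probability (measurableTypeR R) R).
Local Notation Rm := (measurableTypeR R).

Lemma bddm_tpoly s : bddm (tpoly s : Rm -> R[i]).
Proof.
by apply: bddm_sum => p; apply: bddmM; [exact: bddm_cst|exact: bddm_e2pi].
Qed.

Lemma Cintegral_tpoly s x :
  Cintegral mu (fun t => tpoly s t * (e2pi (x * t))^*%C) =
  \sum_(p <- s) p.2 * fourier mu (p.1 - x).
Proof.
have -> : (fun t : Rm => tpoly s t * (e2pi (x * t))^*%C) =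
    (fun t => \sum_(p <- s) p.2 * e2pi ((p.1 - x) * t)).
  apply/funext => t; rewrite /tpoly mulr_suml; apply: eq_bigr => p _.
  by rewrite -e2piN -mulrA -e2piD mulrBl.
rewrite Cintegral_sum => [|p]; last by apply: bddmM; [exact: bddm_cst|exact: bddm_e2pi].
by apply: eq_bigr => p _; rewrite CintegralZ //; exact: bddm_e2pi.
Qed.

Lemma L2sqB_bddm (f g : Rm -> R[i]) : bddm f -> bddm g ->
  L2sq mu (fun x => f x - g x) = (L2sq mu f + L2sq mu g -
    (2 * complex.Re (Cintegral mu (fun x => g x * (f x)^*%C)))%:E)%E.
Proof.
move=> bf bg; have bfc := bddm_conj bf; have bgc := bddm_conj bg.
have bgf : bddm (fun x => g x * (f x)^*%C) by exact: bddmM.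
have bN : bddm (fun x => f x - g x).
  by under eq_fun do rewrite -mulN1r; apply: bddmD => //; apply: bddmM => //; exact: bddm_cst.
rewrite !L2sq_bddm // -[RHS]/((_ + _ - _)%:E); congr EFin.
have -> : (fun x => (f x - g x) * (f x - g x)^*%C) =
    (fun x => (f x * (f x)^*%C + g x * (g x)^*%C) +
      (-1) * (g x * (f x)^*%C + (g x * (f x)^*%C)^*%C)).
  apply/funext => x; case: (f x) (g x) => a b [c d]; simpc; congr (_ +i* _)%C; ring.
rewrite CintegralD; last first.
- apply: bddmM; first exact: bddm_cst.
  by apply: bddmD => //; exact: bddm_conj.
- by apply: bddmD; exact: bddmM.
rewrite CintegralD; [|exact: bddmM|exact: bddmM].
rewrite CintegralZ; last by apply: bddmD => //; exact: bddm_conj.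
rewrite CintegralD //; last exact: bddm_conj.
rewrite Cintegral_conj //; case: (Cintegral mu (fun x => g x * _)) => a b.
by rewrite !Re_add Re_mul Re_add /=; ring.
Qed.

Lemma L2sq_e2pi x : L2sq mu (fun t => e2pi (x * t)) = 1%E.
Proof.
rewrite L2sq_bddm; last exact: bddm_e2pi.
under eq_fun do rewrite mul_conj nsq_e2pi.
by rewrite Cintegral_cst.
Qed.

(** Pythagoras: mu^(x - l) is the inner product of e(x t) with e(l t). Both the cross term [e1] and
    the squared norm [e2] of the projection equal the sum of the squared coefficients. *)
Lemma L2sq_proj x (r : seq R) : uniq r ->
  (forall l l', l \in r -> l' \in r -> l != l' -> fourier mu (l - l') = 0) ->
  L2sq mu (fun t => e2pi (x * t) - tpoly [seq (l, fourier mu (x - l)) | l <- r] t) =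
  (1 - \sum_(l <- r) nsq (fourier mu (x - l)))%:E.
Proof.
move=> ur orth; set s := [seq _ | l <- r].
have bs := bddm_tpoly s.
rewrite L2sqB_bddm //; last exact: bddm_e2pi.
rewrite L2sq_e2pi Cintegral_tpoly L2sq_bddm //.
have e1 : \sum_(p <- s) p.2 * fourier mu (p.1 - x) = (\sum_(l <- r) nsq (fourier mu (x - l)))%:C%C.
  rewrite big_map rmorph_sum; apply: eq_bigr => l _ /=.
  by rewrite -[l - x]opprB fourierN mul_conj.
have e2 : Cintegral mu (fun t => tpoly s t * (tpoly s t)^*%C) =
    (\sum_(l <- r) nsq (fourier mu (x - l)))%:C%C.
  have -> : (fun t : Rm => tpoly s t * (tpoly s t)^*%C) =
     (fun t => \sum_(l <- r) (fourier mu (x - l))^*%C * (tpoly s t * (e2pi (l * t))^*%C)).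
    apply/funext => t; rewrite {2}/tpoly big_map rmorph_sum mulr_sumr.
    by apply: eq_bigr => l _; rewrite rmorphM mulrCA.
  rewrite Cintegral_sum => [|l]; last first.
    apply: bddmM; first exact: bddm_cst.
    by apply: bddmM => //; apply: bddm_conj; exact: bddm_e2pi.
  rewrite rmorph_sum big_seq [RHS]big_seq; apply: eq_bigr => l lr.
  rewrite CintegralZ; last by apply: bddmM => //; apply: bddm_conj; exact: bddm_e2pi.
  rewrite Cintegral_tpoly big_map (big_rem l) //= subrr fourier0 mulr1 mulrDr.
  rewrite [_ * fourier mu _]mulrC mul_conj big_seq big1 ?mulr0 ?addr0 // => l'.
  rewrite (mem_rem_uniq _ ur) inE => /andP[l'l l'r].
  by rewrite orth ?mulr0.
rewrite e1 e2 /= -!EFinD; congr EFin; ring.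
Qed.

End Projection.

(** Lambda asks for at least two digits while [digit_sums] allows any number; padding with the digit
    0 reconciles the two. *)
Lemma Lambda_digit_sums (R : realType) (N : int) (S : {fset int}) (x : R) : 0 \in S ->
  Lambda N [fset (s%:~R : R) | s in S] x <->
  exists n l, l \in digit_sums N S n /\ x = l%:~R.
Proof.
move=> S0; split.
  move=> [k [a [_ aS ->]]].
  elim: k a aS => [|k IH] a aS.
    have /imfsetP[s /= sS as0] := aS 0%N (leqnn _).
    exists 1%N, s; rewrite big_nat1 expr0 mulr1; split => //.
    by apply/allpairsP; exists (s, 0); rewrite /= inE mulr0 addr0.
  have [n [l [lL lE]]] := IH (fun j => a j.+1) (fun j jk => aS j.+1 jk).
  have /imfsetP[s /= sS as0] := aS 0%N (leq0n _).
  exists n.+1, (s + N * l); split; first by apply/allpairsP; exists (s, l).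
  rewrite big_nat_recl // expr0 mulr1 as0 intrD intrM -lE mulr_sumr; congr (_ + _).
  by apply: eq_bigr => j _; rewrite exprS mulrCA.
move=> [n [l [lL ->]]].
have [a [aS aE]] : exists a : nat -> int, (forall j, a j \in S) /\
    forall k, (n <= k)%N -> l = \sum_(0 <= j < k) a j * N ^+ j.
  elim: n l lL => [|n IH] l.
    rewrite inE => /eqP ->; exists (fun=> 0); split => // k _.
    by rewrite big1 // => j _; rewrite mul0r.
  move=> /allpairsP[[s b] /= [sS bL ->]]; have [a [aS aE]] := IH _ bL.
  exists (fun j => if j is j'.+1 then a j' else s); split; first by case.
  case=> // k nk; rewrite big_nat_recl // expr0 mulr1 (aE k) // mulr_sumr.
  by congr (_ + _); apply: eq_bigr => j _; rewrite exprS mulrCA.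
(* The choice k = n + 1 ensures k >= 1 even for n = 0; the digits from n on contribute nothing. *)
exists n.+1, (fun j => (a j)%:~R); split => //.
  by move=> j _; apply/imfsetP; exists (a j).
have -> := aE n.+2 (leq_trans (leqnSn n) (leqnSn n.+1)).
rewrite (big_morph (fun z : int => z%:~R : R) (@intrD R) (erefl _)).
by apply: eq_bigr => j _; rewrite intrM (rmorphXn (intmul (1 : R))).
Qed.

Lemma eta_cycleP (N : int) (S : {fset int}) : N != 0 ->
  eta_cycle N S <->
  (exists (m : nat) (s eta : nat -> int),
     [/\ (1 <= m)%N,
         forall j, (j < m)%N -> s j \in S /\ eta j != 0,
         eta m = eta 0%N,
         s m = s 0%N &
         forall j, (j < m)%N ->
           ((eta j.+1)%:Q = N%:Q^-1 * (eta j + s j)%:Q)]).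
Proof.
move=> N0; have NQ : N%:Q != 0 by rewrite intr_eq0.
split=> -[m [s [eta [m0 sS etam sm rec]]]]; exists m, s, eta; split => // j jm.
  by rewrite -rec // intrM mulKf.
by apply: (@intr_inj rat); rewrite intrM rec // mulVKf.
Qed.

Theorem theorem1p3 (R : realType) (N : int) (D S : {fset int})
    (mu : probability (measurableTypeR R) R) :
  1 < `|N| ->
  0 \in D -> fset_gcd D = 1 ->
  0 \in S ->
  compatible_pair [fset (d%:~R / N%:~R : R) | d in D]
                  [fset (s%:~R : R) | s in S] ->
  is_muND N D mu ->
  (~ spectral_pair mu (Lambda N [fset (s%:~R : R) | s in S])) <->
  (exists (m : nat) (s eta : nat -> int),
     [/\ (1 <= m)%N,
         forall j, (j < m)%N -> s j \in S /\ eta j != 0,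
         eta m = eta 0%N,
         s m = s 0%N &
         forall j, (j < m)%N ->
           ((eta j.+1)%:Q = N%:Q^-1 * (eta j + s j)%:Q)]).
Proof.
move=> N_gt1 D0 gcdD S0 compat muND.
have N0 : N != 0 by rewrite -normr_gt0 (lt_trans _ N_gt1).
apply: iff_trans (eta_cycleP S N0).
set L := Lambda N _.
have LP x : L x <-> exists n l, l \in digit_sums N S n /\ x = l%:~R by exact: Lambda_digit_sums.
pose p x : R := nsq (mask_poly D x); pose g x : R := nsq (fourier mu x).
have p_ge0 x : 0 <= p x by exact: nsq_ge0.
have p_per x (k : int) : p (x + k%:~R) = p x by rewrite /p mask_per.
have p_sum x : \sum_(s <- S) p ((x + s%:~R) / N%:~R) = 1 by exact: compatible_mask_sum.
have p_eq1 x : p x = 1 -> exists k : int, x = k%:~R.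
  move=> px; apply: (fset_gcd_int gcdD) => d dD.
  by apply: e2pi_eq1; exact: (mask_eq1_const D0 px).
have g_ge0 x : 0 <= g x by exact: nsq_ge0.
have g_le1 x : g x <= 1 by exact: nsq_fourier_le1.
have g0 : g 0 = 1 by rewrite /g fourier0 nsq1.
have gE x : g x = p (x / N%:~R) * g (x / N%:~R).
  by rewrite /g (fourierE D0 muND) nsqM.
have g_cont : continuous g by exact: continuous_nsq_fourier.
have g_zeros B : exists zs : seq R, forall x, `|x| <= B -> g x = 0 -> x \in zs.
  apply: (refinable_zeros (p := p) N_gt1) => // {}B.
  have [zs zsP] := mask_zeros D0 B; exists zs => x xB /nsq_eq0; exact: zsP.
split.
- move=> nsp; apply: contrapT => ncyc; apply: nsp.
  have Q1 := no_cycle_limQ N_gt1 S0 p_ge0 p_per p_sum p_eq1 g_ge0 g_le1 g0 gE g_cont g_zeros ncyc.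
  have orth l l' : L l -> L l' -> l != l' -> fourier mu (l - l') = 0.
    move=> /LP[n [a [aL ->]]] /LP[n' [a' [aL' ->]]] ne.
    apply: nsq_eq0; rewrite -intrB.
    (* Both elements are viewed as digit sums of the same length. *)
    apply: (g_orth N_gt1 p_ge0 p_per p_sum g0 gE (n := maxn n n')).
    + by apply: (digit_sums_sub S0 _ aL); rewrite leq_maxl.
    + by apply: (digit_sums_sub S0 _ aL'); rewrite leq_maxr.
    + by apply: contraNneq ne => ->.
  split.
  + by move=> l _; exact: in_L2_e2pi.
  + move=> l l' Ll Ll'; rewrite L2inner_e2pi; have [->|ne] := eqVneq l l'.
      by rewrite subrr fourier0.
    by rewrite orth.
  (* The squared distance from e(x t) to its projection on the digit sums of length n is 1 - R^n
     g(-x), because |mu^(x - l)|^2 = g(-x + l); it tends to 1 - Q(-x) = 0. *)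
  + have app x : span_approx mu L (fun t => e2pi (x * t)).
      move=> e e0.
      have cvgQ : iter n (transfer N S p) g (- x) @[n --> \oo] --> limQ N S p g (- x).
        exact: limQ_cvg.
      have [n _ /(_ n (leqnn _)) /= Qn] : \forall n \near \oo,
          1 - e < iter n (transfer N S p) g (- x).
        by move/cvgr_gt: cvgQ; apply; rewrite Q1 ltrBlDr ltrDl.
      pose r : seq R := [seq a%:~R | a <- digit_sums N S n].
      have rL l : l \in r -> L l by move=> /mapP[a aL ->]; apply/LP; exists n, a.
      have ur : uniq r.
        by rewrite map_inj_uniq; [exact: (digit_sums_uniq N_gt1 p_ge0 p_per p_sum g0 gE)|exact: intr_inj].
      exists [seq (l, fourier mu (x - l)) | l <- r]; split.
        by move=> _ /mapP[l lr ->]; exact: rL.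
      rewrite L2sq_proj //; last by move=> l l' /rL Ll /rL Ll'; exact: orth.
      rewrite lte_fin ltrBlDr addrC -ltrBlDr; apply: lt_le_trans Qn _.
      rewrite iter_transferE // big_map; apply: ler_sum => a _.
      by rewrite /g -nsq_conj -fourierN opprD opprK.
    move=> f f2 e e0.
    have [s [sL fs]] := span_approx_L2 app f2 (exprn_gt0 2 e0).
    exists (size s), (fun k => (nth (0, 0) s k).1), (fun k => (nth (0, 0) s k).2).
    split; first by move=> k; apply: sL; rewrite mem_nth.
    apply/L2norm_lt => //.
    rewrite (_ : (fun x => _) = (fun x => f x - tpoly s x)) //.
    by apply/funext => x; rewrite /tpoly (big_nth (0, 0)) big_mkord.
(* The function e(-k t) is orthogonal to every e(l t) with l in Lambda, so its squared distance to
   any combination of them is at least 1; density fails for eps = 1. *)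
- move=> cyc [_ _ dense].
  have [k kP] := cycle_g0 N_gt1 S0 p_ge0 p_per p_sum g0 gE cyc.
  have [n [idx [c [idxL lt1]]]] := dense _ (in_L2_e2pi mu (- k%:~R)) 1 ltr01.
  move: lt1; rewrite (_ : (fun x => _) = (fun x => e2pi (- k%:~R * x) -
      tpoly [seq (idx i, c i) | i <- index_enum 'I_n] x)); last first.
    by apply/funext => x; rewrite /tpoly big_map.
  move=> /L2norm_lt => /(_ ltr01); rewrite L2sqB_bddm; [|exact: bddm_e2pi|exact: bddm_tpoly].
  rewrite L2sq_e2pi Cintegral_tpoly big_map big1.
    by rewrite expr1n mulr0 sube0 -[X in (_ < X)%E]adde0 lteD2lE // ltNge L2sq_ge0.
  move=> i _; have /LP[m [l [lL ->]]] := idxL i.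
  have : g (k + l)%:~R = 0 by exact: kP lL.
  by move=> /nsq_eq0; rewrite intrD opprK addrC => ->; rewrite mulr0.
Qed.
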